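(* Consider the single-source heterogeneous $n$-server network (described in the context) with arrival rates $\lambda_1,\dots,\lambda_n>0$ and service rates $\mu_1,\dots,\mu_n>0$; let $\Lambda=\sum_j\lambda_j$, $M=\sum_j\mu_j$, and for each permutation $q$ of $[n]$ let $\pi_q=\prod_{k=1}^{n-1}\frac{\lambda_{q_k}}{\sum_{j=k}^n\lambda_{q_j}}$. Consider the linear system in the unknowns $v_{q,0},v_{q,1},\dots,v_{q,n}$ ($q$ ranging over all permutations of $[n]$): $$(\Lambda+M)v_{q,0}=\pi_q+\lambda_{q_1}\sum_{p\in H_q^{-1}}v_{p,0}+\sum_{i=1}^n\mu_{q_i}v_{q,q_i},$$ $$\Lambda\, v_{q,q_1}=\pi_q,$$ and for $2\le k\le n$, $$(\Lambda+M)v_{q,q_k}=\pi_q+\lambda_{q_1}\sum_{p\in H_q^{-1}}v_{p,q_k}+\sum_{i=1}^{k-1}\mu_{q_i}v_{q,q_i}+\Big(\sum_{i=k}^n\mu_{q_i}\Big)v_{q,q_k}.$$ This system has a unique solution, it is non-negative, and the average age of information at the monitor equals $\Delta=\sum_q v_{q,0}$.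
   Context: Network model: one information source, $n$ servers and a monitor. Updates arrive at server $j$ according to a Poisson process of rate $\lambda_j>0$, independent across servers; an update's generation time is its arrival time. Server $j$ transmits to the monitor with i.i.d. exponential service times of rate $\mu_j>0$. Each server uses LCFS with preemption in service: a new arrival immediately replaces the update in service; on service completion the update is delivered to the monitor and the server is idle until the next arrival. With $u(t)$ the largest generation time among updates delivered by time $t$, the age is $\Delta(t)=t-u(t)$ and the average age is $\Delta=\lim_{T\to\infty}\frac1T\int_0^T\Delta(t)dt$. Permutations of $[n]$ are tuples $q=(q_1,\dots,q_n)$; $h_i(q)=(q_i,q_1,\dots,q_{i-1},q_{i+1},\dots,q_n)$ and $H_q^{-1}=\{h_i^{-1}(q):i\in[n]\}=\{(q_2,\dots,q_i,q_1,q_{i+1},\dots,q_n):i\in[n]\}$. Variables $v_{q,j}$ for $j\ge1$ are indexed by physical server labels $j\in[n]$. *)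

(* Defs.v *)
From HB Require Import structures.
From mathcomp Require Import all_boot all_order all_algebra all_fingroup.
From mathcomp Require Import all_classical all_reals all_analysis.
From mathcomp Require Import exponential_distribution.
From mathcomp Require Import zify.
Set Implicit Arguments. Unset Strict Implicit. Unset Printing Implicit Defensive.
Import Order.TTheory GRing.Theory Num.Theory.
Local Open Scope classical_set_scope.
Local Open Scope ring_scope.

(* Positions of a permutation q = (q_1,...,q_n) are 0-indexed:  q_{k+1} = q k. *)

Definition pos0 (n : nat) (hn : (0 < n)%N) : 'I_n := Ordinal hn.

Definition hpos (n : nat) (i j : 'I_n) : 'I_n :=
  if (j < i)%N then insubd j j.+1 else if j == i then insubd j 0 else j.

Lemma hpos_inj (n : nat) (i : 'I_n) : injective (hpos i).
Proof.
have E1 (j : 'I_n) : (j < i)%N -> val (hpos i j) = j.+1.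
  move=> ji; rewrite /hpos ji val_insubd.
  by rewrite (leq_ltn_trans ji (ltn_ord i)).
have E2 : val (hpos i i) = 0%N.
  by rewrite /hpos ltnn eqxx val_insubd (leq_ltn_trans (leq0n _) (ltn_ord i)).
have E3 (j : 'I_n) : (i < j)%N -> val (hpos i j) = j.
  move=> ij; rewrite /hpos ltnNge (ltnW ij) /=.
  by rewrite ifF //; apply/negbTE; rewrite neq_ltn ij orbT.
have V (j : 'I_n) : val (hpos i j) =
    if (j < i)%N then j.+1 else if (i < j)%N then val j else 0%N.
  case: (ltngtP j i) => [ji|ij|/val_inj ->]; [exact: E1|exact: E3|exact: E2].
move=> x y /(congr1 val); rewrite !V => H; apply/val_inj.
move: H; case: (ltngtP x i); case: (ltngtP y i) => //= *; lia.
Qed.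

Definition hpos_perm (n : nat) (i : 'I_n) : 'S_n := perm (@hpos_inj n i).

(* h_i^{-1}(q) = (q_2,...,q_i,q_1,q_{i+1},...,q_n)  (i here 0-indexed) *)
Definition hinv (n : nat) (q : 'S_n) (i : 'I_n) : 'S_n := (hpos_perm i * q)%g.

Definition Hinv (n : nat) (q : 'S_n) : {set 'S_n} := [set hinv q i | i : 'I_n].

Section system.
Context {R : realType} {n : nat}.

Definition Lam (lam : 'I_n -> R) : R := \sum_(j : 'I_n) lam j.

Definition piq (lam : 'I_n -> R) (q : 'S_n) : R :=
  \prod_(k : 'I_n | (k.+1 < n)%N)
     (lam (q k) / \sum_(j : 'I_n | (k <= j)%N) lam (q j)).

(* The linear system.  Unknowns: v q None = v_{q,0};  v q (Some j) = v_{q,j}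
   for the physical server label j. *)
Definition age_system (hn : (0 < n)%N) (lam mu : 'I_n -> R)
    (v : 'S_n -> option 'I_n -> R) : Prop :=
  forall q : 'S_n,
  let q1 := q (pos0 hn) in
  [/\ (Lam lam + Lam mu) * v q None =
        piq lam q + lam q1 * (\sum_(p in Hinv q) v p None)
        + \sum_(i : 'I_n) mu (q i) * v q (Some (q i)),
      Lam lam * v q (Some q1) = piq lam q
    & forall k : 'I_n, (1 <= k)%N ->
      (Lam lam + Lam mu) * v q (Some (q k)) =
        piq lam q + lam q1 * (\sum_(p in Hinv q) v p (Some (q k)))
        + \sum_(i : 'I_n | (i < k)%N) mu (q i) * v q (Some (q i))
        + (\sum_(i : 'I_n | (k <= i)%N) mu (q i)) * v q (Some (q k))].
End system.

Section model.
Context {d : measure_display} {Omega : measurableType d} {R : realType}.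
Variable P : probability Omega R.

Definition exp_distributed (r : R) (Y : Omega -> R) : Prop :=
  measurable_fun setT Y /\
  forall A : set R, measurable A -> P (Y @^-1` A) = exponential_prob r A.

Definition mutually_independent {I : eqType} (Y : I -> Omega -> R) : Prop :=
  (forall i, measurable_fun setT (Y i)) /\
  forall (s : seq I) (B : I -> set R), uniq s -> (forall i, measurable (B i)) ->
    P (\bigcap_(i in [set` s]) (Y i @^-1` B i)) =
    (\prod_(i <- s) P (Y i @^-1` B i))%E.

Variable n : nat.
(* X j k : k-th interarrival time at server j (k = 0: time of first arrival);
   S j k : service time given to the k-th update arriving at server j. *)
Variables (X S : 'I_n -> nat -> Omega -> R).

Definition all_times : ('I_n * nat) + ('I_n * nat) -> Omega -> R :=
  fun z => match z with inl (j, k) => X j k | inr (j, k) => S j k end.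

(* arrival (= generation) time of the k-th update at server j *)
Definition arrival (j : 'I_n) (k : nat) (w : Omega) : R :=
  \sum_(i < k.+1) X j i w.

(* LCFS with preemption: the k-th update of server j is delivered (at time
   arrival j k w + S j k w) iff its service ends before the next arrival at j *)
Definition delivered (j : 'I_n) (k : nat) (w : Omega) : Prop :=
  S j k w < X j k.+1 w.

(* u(t): largest generation time among updates delivered by time t
   (0 if none: the monitor starts at time 0 with age 0) *)
Definition freshest (w : Omega) (t : R) : R :=
  sup ([set 0] `|` [set g | exists j k, [/\ delivered j k w,
          g = arrival j k w & arrival j k w + S j k w <= t]]).

Definition age (w : Omega) (t : R) : R := t - freshest w t.

Definition avg_age_upto (w : Omega) (T : R) : R :=
  T^-1 * Rintegral lebesgue_measure `[0, T] (age w).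
End model.

(* Main.v *)
(* The servers are independent, and the age exceeds a at time t iff no server
   delivers in ]t - a, t] an update generated after t - a.  The future of a server
   being independent of its past, the probability [idle j a] of this event for
   server j is that of no delivery within a time a, starting with an empty server;
   it solves G' = mu_j (exp (- lam_j a) - G).  The mean age is the integral of
   \prod_j [idle j].  More generally the integrals V_A of
   \prod_(j in A) exp (- lam_j a) \prod_(j notin A) [idle j a] satisfy
     (lam(A) + mu(~A)) V_A = 1 + \sum_(j notin A) mu_j V_(j |: A).
   Summed over q, the system of the theorem says that
   \sum_q v_(q, [freshest_in q A]) solves this recursion, so that
   \sum_q v_(q, 0) is V_set0.  The same aggregation, applied to the negative part of
   a solution, forces that part to vanish: hence non-negativity, then uniqueness
   and, the system being square, existence.

   Almost sure convergence comes from discretization: on a grid of mesh dl, the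
   time average is within O(dl) of the mean number of events: age at least
   i dl at time k dl.  Events relative to disjoint time intervals are independent and the age
   has exponential tails, so the fluctuations of these sums have variance O(N) and
   a second-moment bound along squares gives a strong law; then dl tends to 0. *)
Require Import Defs.
From HB Require Import structures.
From mathcomp Require Import all_boot all_order all_algebra all_fingroup.
From mathcomp Require Import all_classical all_reals all_analysis.
From mathcomp Require Import measurable_realfun exponential_distribution.
From mathcomp Require Import zify ring lra.
Set Implicit Arguments.
Unset Strict Implicit.
Unset Printing Implicit Defensive.
Import Order.TTheory GRing.Theory Num.Theory.
Import numFieldNormedType.Exports.
Local Open Scope classical_set_scope.
Local Open Scope ring_scope.

(** * Independent families and iterated integration *)

(** Conditioning uses no conditional expectation: Omega carries the sigma-algebra generated by some
    of the clocks, and an event depending on two disjoint groups of clocks is integrated over two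
    independent copies of Omega. Why preemption is harmless: a replacement starts a fresh service,
    and the service it interrupts is memoryless, so once a server holds an update its next delivery
    comes after an exponential time of rate mu_j, whatever the arrivals. Unboundedly many
    replacements may occur, so this is proved exactly for a server with finitely many preemptions,
    then passed to the limit with a geometric error. At a fixed time the index of the next update is
    random and an interarrival interval straddles that time. Events are therefore cut by the number
    of arrivals so far, and memorylessness restarts the straddling interval. Why the aggregated
    system closes: moving a server outside A to the front of q keeps the order inside A, while for a
    server of A the arrival term is absent from the equation used. Hence only lam(A) is left of the
    arrival rates; services at servers of A cancel likewise, and those outside A enlarge A. *)

Section independence.
Context {d : measure_display} {Omega : measurableType d} {R : realType}.
Context {I : eqType} (P : probability Omega R) (Y : I -> Omega -> R).

(** These generate on Omega itself, rather than on a product of real lines, the sigma-algebra of the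
    variables indexed by [A]. The identity of Omega then serves as the random element carrying all
    of them at once. *)
Definition cylinders (A : set I) : set (set Omega) :=
  [set E | exists (s : seq I) (B : I -> set R), [/\ forall i, i \in s -> A i,
     forall i, measurable (B i) &
     E = \bigcap_(i in [set` s]) (Y i @^-1` B i)]].

Local Notation sub_space A := (g_sigma_algebraType (cylinders A)).

Lemma cylinders_setI (A : set I) : setI_closed (cylinders A).
Proof.
move=> _ _ [s1 [B1 [sA1 mB1 ->]]] [s2 [B2 [sA2 mB2 ->]]].
exists (s1 ++ s2), (fun i => (if i \in s1 then B1 i else setT) `&`
                             (if i \in s2 then B2 i else setT)); split.
- by move=> i; rewrite mem_cat => /orP[/sA1|/sA2].
- by move=> i; apply: measurableI; case: ifP.
- apply/seteqP; split=> [w [h1 h2] i /=|w h].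
    rewrite mem_cat => _; split.
      by case: ifPn => // /h1.
    by case: ifPn => // /h2.
  split=> i /= si.
    by have := h i; rewrite /= mem_cat si /= => /(_ isT) [].
  by have := h i; rewrite /= mem_cat si orbT /= => /(_ isT) [].
Qed.

Lemma sub_space_rv (A : set I) i (B : set R) : A i -> measurable B ->
  measurable (Y i @^-1` B : set (sub_space A)).
Proof.
move=> Ai mB; apply: sub_sigma_algebra; exists [:: i], (fun=> B); split => //.
- by move=> j; rewrite inE => /eqP ->.
- apply/seteqP; split=> [w h j /=|w h].
    by rewrite inE => /eqP ->.
  by apply: h; rewrite /= inE.
Qed.

Lemma sub_space_measurable_fun (A : set I) i : A i ->
  measurable_fun setT (Y i : sub_space A -> R).
Proof. by move=> Ai _ B mB; rewrite setTI; exact: sub_space_rv. Qed.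

Hypothesis indepY : mutually_independent P Y.

Lemma cylinders_measurable (A : set I) : cylinders A `<=` measurable.
Proof.
move=> _ [s [B [_ mB ->]]]; apply: fin_bigcap_measurable => [|i _];
  first exact: finite_seq.
by have := indepY.1 i measurableT _ (mB i); rewrite setTI.
Qed.

Lemma sub_space_measurable (A : set I) (E : set Omega) :
  measurable (E : set (sub_space A)) -> measurable E.
Proof.
apply: smallest_sub; first exact: sigma_algebra_measurable.
exact: cylinders_measurable.
Qed.

Lemma cylinders_indep (A B : set I) E F : A `&` B = set0 ->
  cylinders A E -> cylinders B F -> P (E `&` F) = (P E * P F)%E.
Proof.
move=> AB [s1 [B1 [sA1 mB1 ->]]] [s2 [B2 [sA2 mB2 ->]]].
(* A cylinder may list an index twice, while independence is stated for duplicate-free lists. *)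
have und s (C : I -> set R) : \bigcap_(i in [set` s]) (Y i @^-1` C i) =
    \bigcap_(i in [set` undup s]) (Y i @^-1` C i).
  suff -> : [set` undup s] = [set` s] by [].
  by apply/seteqP; split=> i /=; rewrite mem_undup.
rewrite (und s1) (und s2).
pose C i := if i \in s1 then B1 i else B2 i.
have mC i : measurable (C i) by rewrite /C; case: ifP.
have C2 i : i \in s2 -> C i = B2 i.
  rewrite /C; case: ifPn => // i1 i2.
  by have : (A `&` B) i by [split; [exact: sA1|exact: sA2]]; rewrite AB.
have C1 i : i \in s1 -> C i = B1 i by rewrite /C => ->.
have -> : \bigcap_(i in [set` undup s1]) (Y i @^-1` B1 i) =
          \bigcap_(i in [set` undup s1]) (Y i @^-1` C i).
  by apply: eq_bigcapr => i /=; rewrite mem_undup => /C1 ->.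
have -> : \bigcap_(i in [set` undup s2]) (Y i @^-1` B2 i) =
          \bigcap_(i in [set` undup s2]) (Y i @^-1` C i).
  by apply: eq_bigcapr => i /=; rewrite mem_undup => /C2 ->.
rewrite -bigcap_setU.
have -> : [set` undup s1] `|` [set` undup s2] = [set` undup s1 ++ undup s2].
  apply/seteqP; split=> i /=; rewrite mem_cat; first by case=> ->; rewrite ?orbT.
  by move/orP.
rewrite !indepY.2 ?undup_uniq ?big_cat//.
rewrite cat_uniq !undup_uniq /= andbT; apply/hasPn => i; rewrite !mem_undup => i2.
apply/negP => i1; have : (A `&` B) i by split; [exact: sA1|exact: sA2].
by rewrite AB.
Qed.

(** Both sides are finite measures in [F], namely [P] restricted to [E] and [P] scaled by [P E].
    They agree on the pi-system [G], hence on the sigma-algebra it generates. *)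
Lemma pi_indep (G : set (set Omega)) (E : set Omega) :
  setI_closed G -> G `<=` measurable -> measurable E ->
  (forall F, G F -> P (F `&` E) = (P E * P F)%E) ->
  forall F, <<s G >> F -> P (F `&` E) = (P E * P F)%E.
Proof.
move=> GI Gm mE GE F sF.
have PE0 : 0 <= fine (P E) by exact: fine_ge0.
pose m1 : {measure set Omega -> \bar R} := mrestr P mE.
pose m2 : {measure set Omega -> \bar R} := mscale (NngNum PE0) P.
have m2E X : m2 X = (P E * P X)%E.
  by rewrite /m2 /= /mscale /= fineK // fin_num_measure.
rewrite -m2E; suff : m1 F = m2 F by [].
apply: (g_sigma_algebra_measure_unique_trace G setT) => //.
- by move=> X [/Gm].
- move=> X Z [GX _] [GZ _]; split => //; exact: GI.
- by rewrite m2E /m1 /= /mrestr setTI probability_setT mule1.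
- by move=> X [GX _]; rewrite m2E -GE.
- by rewrite /m1 /= /mrestr setTI ltey_eq fin_num_measure.
- suff -> : [set X | G X /\ X `<=` setT] = G by [].
  by apply/seteqP; split=> X //= -[].
Qed.

Lemma sub_space_indep (A B : set I) (E F : set Omega) : A `&` B = set0 ->
  measurable (E : set (sub_space A)) -> measurable (F : set (sub_space B)) ->
  P (E `&` F) = (P E * P F)%E.
Proof.
move=> AB mE mF.
have mF' := sub_space_measurable mF.
rewrite [RHS]muleC; apply: (pi_indep (@cylinders_setI A)) => //.
  exact: cylinders_measurable.
move=> {mE}E cE; rewrite setIC muleC.
apply: (pi_indep (@cylinders_setI B)) => //.
- exact: cylinders_measurable.
- exact: cylinders_measurable cE.
by move=> {mF mF'}F cF; rewrite setIC; exact: cylinders_indep cE cF.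
Qed.

Lemma sub_space_id_measurable (A : set I) :
  measurable_fun setT (id : Omega -> sub_space A).
Proof. by move=> _ E mE; rewrite setTI; exact: sub_space_measurable mE. Qed.

End independence.

Notation sub_space Y A := (g_sigma_algebraType (cylinders Y A)).

Section decoupling.
Context {d d1 d2 : measure_display} {Omega : measurableType d} {R : realType}.
Context (T1 : measurableType d1) (T2 : measurableType d2).
Context (P : probability Omega R) (U : Omega -> T1) (V : Omega -> T2).

(** The factorization on rectangles identifies the law of the pair with the product of the two laws;
    Tonelli then gives the iterated integral. *)
Lemma integral_decouple (f : T1 * T2 -> \bar R) :
  measurable_fun setT U -> measurable_fun setT V ->
  (forall A B, measurable A -> measurable B ->
    P (U @^-1` A `&` V @^-1` B) = (P (U @^-1` A) * P (V @^-1` B))%E) ->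
  measurable_fun setT f -> (forall z, (0 <= f z)%E) ->
  (\int[P]_w f (U w, V w) = \int[P]_w \int[P]_w' f (U w, V w'))%E.
Proof.
move=> mU mV UV mf f0.
pose iA : {mfun Omega >-> T1} := mfun_Sub (mem_set mU).
pose iB : {mfun Omega >-> T2} := mfun_Sub (mem_set mV).
have mAB : measurable_fun setT (fun w => (U w, V w)).
  exact/measurable_fun_pair.
pose iAB : {mfun Omega >-> (T1 * T2)%type} := mfun_Sub (mem_set mAB).
pose PA := distribution P iA. pose PB := distribution P iB.
pose PAB := distribution P iAB.
have E : forall X, measurable X -> (PA \x PB)%E X = PAB X.
  by apply: product_measure_unique => E F mE mF; exact: UV.
have -> : (\int[P]_w f (U w, V w) = \int[PAB]_z f z)%E.
  by rewrite ge0_integral_distribution.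
rewrite (eq_measure_integral (PA \x PB)%E); last first.
  by move=> X mX _; exact: (esym (E X mX)).
rewrite fubini_tonelli1 // ge0_integral_distribution//.
- apply: eq_integral => w _ /=.
  rewrite /fubini_F ge0_integral_distribution//.
  exact: measurableT_comp.
- exact: measurable_fun_fubini_tonelli_F.
- by move=> x; apply: integral_ge0.
Qed.

End decoupling.

Section sub_space_decouple.
Context {d : measure_display} {Omega : measurableType d} {R : realType}.
Context {I : eqType} (P : probability Omega R) (Y : I -> Omega -> R).
Hypothesis indepY : mutually_independent P Y.

Lemma integral_sub_space_decouple (A B : set I) (f : Omega * Omega -> \bar R) :
  A `&` B = set0 ->
  measurable_fun [set: (sub_space Y A * sub_space Y B)%type] f ->
  (forall z, (0 <= f z)%E) ->
  (\int[P]_w f (w, w) = \int[P]_w \int[P]_w' f (w, w'))%E.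
Proof.
move=> AB mf f0.
apply: (@integral_decouple _ _ _ _ _ (sub_space Y A) (sub_space Y B) P id id) => //.
- exact: sub_space_id_measurable indepY A.
- exact: sub_space_id_measurable indepY B.
- by move=> E F mE mF; exact: (sub_space_indep indepY AB).
Qed.
End sub_space_decouple.

Section measurable_sets.
Context {d : measure_display} (T : measurableType d) {R : realType}.

Lemma measurable_set_lt (f g : T -> R) : measurable_fun setT f ->
  measurable_fun setT g -> measurable [set z | f z < g z].
Proof.
move=> mf mg; have /(_ measurableT [set true]) := measurable_fun_ltr mf mg.
by rewrite setTI; apply.
Qed.

Lemma measurable_set_le (f g : T -> R) : measurable_fun setT f ->
  measurable_fun setT g -> measurable [set z | f z <= g z].
Proof.
move=> mf mg; have /(_ measurableT [set true]) := measurable_fun_ler mf mg.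
by rewrite setTI; apply.
Qed.

Lemma measurable_set_imply (A B : T -> Prop) : measurable [set z | A z] ->
  measurable [set z | B z] -> measurable [set z | A z -> B z].
Proof.
move=> mA mB; rewrite (_ : [set _ | _] = ~` [set z | A z] `|` [set z | B z]).
  by apply: measurableU => //; exact: measurableC.
apply/seteqP; split=> z /=; last by case.
by move=> AB; have [/AB|] := pselect (A z); [right|left].
Qed.

Lemma measurable_set_and (A B : T -> Prop) : measurable [set z | A z] ->
  measurable [set z | B z] -> measurable [set z | A z /\ B z].
Proof. exact: measurableI. Qed.

Lemma measurable_set_cst (Q : Prop) : measurable [set _ : T | Q].
Proof.
have [q|nq] := pselect Q.
  by rewrite (_ : [set _ | _] = setT) //; apply/seteqP; split.
by rewrite (_ : [set _ | _] = set0) // -subset0 => z.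
Qed.

Lemma measurable_set_forall (A : nat -> T -> Prop) :
  (forall n, measurable [set z | A n z]) -> measurable [set z | forall n, A n z].
Proof.
move=> mA; rewrite (_ : [set _ | _] = \bigcap_n [set z | A n z]).
  exact: bigcapT_measurable.
by apply/seteqP; split=> [z h n _|z h n]; apply: h.
Qed.
End measurable_sets.

(** * Exponential lifetimes *)

Section exponential_law.
Context {d : measure_display} {Omega : measurableType d} {R : realType}.
Variable P : probability Omega R.

(** The clamp at 0 makes this the survival function on the whole line. Remaining times such as
    [b - X] do become negative below, and the value 1 is then the right one. *)
Definition surv (r b : R) : R := expR (- r * Num.max 0 b).

Lemma surv_ge0 r b : 0 <= surv r b. Proof. exact: expR_ge0. Qed.

Lemma surv_neg r b : b <= 0 -> surv r b = 1.
Proof. by move=> b0; rewrite /surv max_l // mulr0 expR0. Qed.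

Lemma surv_pos r b : 0 <= b -> surv r b = expR (- r * b).
Proof. by move=> b0; rewrite /surv max_r. Qed.

Lemma surv_le1 r b : 0 < r -> surv r b <= 1.
Proof.
move=> r0; rewrite /surv -expR0 ler_expR mulNr oppr_le0.
by apply: mulr_ge0; [exact: ltW|rewrite le_max lexx].
Qed.

Lemma measurable_surv r : measurable_fun setT (surv r).
Proof.
rewrite /surv; apply: measurableT_comp => //; apply: measurable_funM => //.
exact: measurable_maxr.
Qed.

Lemma integral_indic_probability A : measurable A ->
  (\int[P]_w (\1_A w)%:E)%E = P A.
Proof. by move=> mA; rewrite integral_indic // setIT. Qed.

Lemma probability_setU_le A B : measurable A -> measurable B ->
  (P (A `|` B) <= P A + P B)%E.
Proof. exact: measureU2. Qed.

Variables (r : R) (Z : Omega -> R).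
Hypothesis (expZ : exp_distributed P r Z).

Let exp_distributed_measurable_eq c : measurable [set w | Z w = c].
Proof. by have := expZ.1 measurableT _ (measurable_set1 c); rewrite setTI. Qed.

Lemma exp_distributed_neg : P [set w | Z w < 0] = 0%E.
Proof.
rewrite (_ : [set _ | _] = Z @^-1` `]-oo, 0[%classic) ?expZ.2 //=.
rewrite /exponential_prob integral0_eq // => x /=; rewrite in_itv /= => x0.
by rewrite lt0_exponential_pdf.
Qed.

Lemma exp_distributed_ge0 : {ae P, forall w, 0 <= Z w}.
Proof.
exists [set w | Z w < 0]; split.
- by apply: measurable_set_lt => //; exact: expZ.1.
- exact: exp_distributed_neg.
- by move=> w /= /negP; rewrite -ltNge.
Qed.

Lemma exp_distributed_singleton c : P [set w | Z w = c] = 0%E.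
Proof.
by rewrite (_ : [set _ | _] = Z @^-1` [set c]) // expZ.2 // /exponential_prob
  integral_set1.
Qed.

Lemma exp_distributed_le b : P [set w | Z w <= b] = (1 - surv r b)%:E.
Proof.
have [b0|b0] := ltP 0 b; last first.
  rewrite surv_neg // subrr; apply/eqP; rewrite eq_le measure_ge0 andbT.
  apply: (@le_trans _ _ (P ([set w | Z w < 0] `|` [set w | Z w = 0]))).
    apply: le_measure; rewrite ?inE.
    - by apply: measurable_set_le => //; exact: expZ.1.
    - apply: measurableU; first by apply: measurable_set_lt => //; exact: expZ.1.
      exact: exp_distributed_measurable_eq.
    - move=> w /= Zb; have := le_trans Zb b0; rewrite le_eqVlt => /orP[/eqP ->|->].
        by right.
      by left.
  apply: (le_trans (probability_setU_le _ _)).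
  - by apply: measurable_set_lt => //; exact: expZ.1.
  - exact: exp_distributed_measurable_eq.
  - by rewrite exp_distributed_neg exp_distributed_singleton adde0.
have mZ := expZ.1.
have mI : measurable [set w | Z w \in `[0, b]].
  by have := mZ measurableT `[0, b]%classic; rewrite setTI; apply.
rewrite surv_pos ?ltW // EFinB -exponential_prob_itv0c // -expZ.2 //.
apply/eqP; rewrite eq_le; apply/andP; split; last first.
  apply: le_measure; rewrite ?inE //; first exact: measurable_set_le.
  by move=> w /=; rewrite in_itv /= => /andP[].
apply: (@le_trans _ _ (P ([set w | Z w < 0] `|` [set w | Z w \in `[0, b]]))).
  apply: le_measure; rewrite ?inE; first exact: measurable_set_le.
    by apply: measurableU => //; exact: measurable_set_lt.
  move=> w /= Zb; rewrite in_itv /= Zb andbT.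
  by have [|] := ltP (Z w) 0; [left|right].
apply: (le_trans (probability_setU_le _ _)) => //; first exact: measurable_set_lt.
by rewrite exp_distributed_neg add0e.
Qed.

Lemma exp_distributed_gt b : P [set w | b < Z w] = (surv r b)%:E.
Proof.
have mZ := expZ.1.
rewrite (_ : [set _ | _] = ~` [set w | Z w <= b]); last first.
  by apply/seteqP; split=> w /=; rewrite real_ltNge ?num_real// => /negP.
rewrite probability_setC; last exact: measurable_set_le.
by rewrite exp_distributed_le -EFinB; congr EFin; ring.
Qed.

Lemma exp_distributed_lt b : P [set w | Z w < b] = (1 - surv r b)%:E.
Proof.
have mZ := expZ.1.
apply/eqP; rewrite eq_le -exp_distributed_le; apply/andP; split.
  apply: le_measure; rewrite ?inE; first exact: measurable_set_lt.
    exact: measurable_set_le.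
  by move=> w /=; exact: ltW.
apply: (@le_trans _ _ (P ([set w | Z w < b] `|` [set w | Z w = b]))).
  apply: le_measure; rewrite ?inE; first exact: measurable_set_le.
    apply: measurableU; first exact: measurable_set_lt.
    exact: exp_distributed_measurable_eq.
  by move=> w /=; rewrite le_eqVlt => /orP[/eqP ->|->]; [right|left].
apply: (le_trans (probability_setU_le _ _)).
- exact: measurable_set_lt.
- exact: exp_distributed_measurable_eq.
- by rewrite exp_distributed_singleton adde0.
Qed.

End exponential_law.

(** * Deliveries of a single server *)

Section undelivered.
Context {R : realType}.
Implicit Types (xi si : nat -> R).

(* [undel xi si k b]: for a server at which the k-th update has just arrived,
   none of the updates k, k+1, ... is delivered within b time units *)
Definition undel xi si k b := forall m, si (k + m)%N < xi (k + m).+1 ->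
  b < \sum_(i < m) xi (k + i).+1 + si (k + m)%N.

(* the same when the (k+K)-th update is never preempted; unlike [undel], its
   probability satisfies an exact recursion on K *)
Fixpoint trunc_undel xi si K k b : Prop :=
  if K is K'.+1 then
    (si k < xi k.+1 -> b < si k) /\ trunc_undel xi si K' k.+1 (b - xi k.+1)
  else b < si k.

Lemma undelS xi si k b : undel xi si k b <->
  (si k < xi k.+1 -> b < si k) /\ undel xi si k.+1 (b - xi k.+1).
Proof.
split=> [h|[h0 h] [|m]].
- split; first by have := h 0%N; rewrite big_ord0 add0r addn0.
  move=> m sx; have := h m.+1; rewrite addnS -addSn => /(_ sx).
  rewrite big_ord_recl addn0 ltrBlDl addrA.
  by under [in X in X -> _]eq_bigr do rewrite lift0 addnS -addSn.
- by rewrite big_ord0 add0r addn0.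
- rewrite addnS -addSn => /h; rewrite big_ord_recl addn0 ltrBlDl addrA.
  by under [in X in _ -> X]eq_bigr do rewrite lift0 addnS -addSn.
Qed.

Lemma undel_neg xi si k b : (forall i, 0 <= xi i) -> (forall i, 0 <= si i) ->
  b < 0 -> undel xi si k b.
Proof.
move=> x0 s0 b0 m _; apply: (lt_le_trans b0).
by rewrite addr_ge0 // sumr_ge0.
Qed.

Lemma trunc_undelE xi si K k b : (forall i, 0 <= xi i) -> (forall i, 0 <= si i) ->
  b < \sum_(i < K) xi (k + i).+1 -> trunc_undel xi si K k b <-> undel xi si k b.
Proof.
move=> x0 s0; elim: K k b => [|K IH] k b.
  rewrite big_ord0 => b0 /=; split=> _; first exact: undel_neg.
  exact: lt_le_trans b0 _.
rewrite big_ord_recl addn0 -ltrBlDl.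
under eq_bigr do rewrite lift0 addnS -addSn.
by move=> /IH H /=; rewrite undelS H.
Qed.

Context {d : measure_display} (T : measurableType d).

Lemma measurable_trunc_undel (x s : nat -> T -> R) (b : T -> R) K k :
  measurable_fun setT b -> (forall i, (k < i)%N -> measurable_fun setT (x i)) ->
  (forall i, (k <= i)%N -> measurable_fun setT (s i)) ->
  measurable [set z | trunc_undel (x ^~ z) (s ^~ z) K k (b z)].
Proof.
move=> mb mx ms; elim: K k b mb mx ms => [|K IH] k b mb mx ms /=.
  by apply: measurable_set_lt => //; exact: ms.
apply: measurable_set_and.
  by apply: measurable_set_imply; apply: measurable_set_lt => //;
    [exact: ms|exact: mx|exact: ms].
apply: IH.
- by apply: measurable_funB => //; exact: mx.
- by move=> i ki; apply: mx; exact: ltnW.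
- by move=> i ki; apply: ms; exact: ltnW.
Qed.

Lemma measurable_undel (x s : nat -> T -> R) (b : T -> R) k :
  measurable_fun setT b -> (forall i, (k < i)%N -> measurable_fun setT (x i)) ->
  (forall i, (k <= i)%N -> measurable_fun setT (s i)) ->
  measurable [set z | undel (x ^~ z) (s ^~ z) k (b z)].
Proof.
move=> mb mx ms; apply: measurable_set_forall => m.
have msm : measurable_fun setT (s (k + m)%N) by apply: ms; rewrite leq_addr.
apply: measurable_set_imply; apply: measurable_set_lt => //.
  by apply: mx; rewrite ltnS leq_addr.
apply: measurable_funD => //; apply: measurable_sum => i.
by apply: mx; rewrite ltnS leq_addr.
Qed.

End undelivered.

Section probability_decouple.
Context {d : measure_display} {Omega : measurableType d} {R : realType}.
Context {I : eqType} (P : probability Omega R) (Y : I -> Omega -> R).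
Hypothesis indepY : mutually_independent P Y.

(** Conditioning on the variables of [A]: they are frozen at [w] while those of [B] are drawn afresh
    as [w']. The reader of [C] decides which occurrence of a clock goes to which copy. *)
Lemma probability_decouple (A B : set I) (C : Omega -> Omega -> Prop) :
  A `&` B = set0 ->
  @measurable _ (sub_space Y A * sub_space Y B)%type [set z | C z.1 z.2] ->
  (P [set w | C w w] = \int[P]_w P [set w' | C w w'])%E.
Proof.
move=> AB mC.
have mC2 w : measurable [set w' | C w w'].
  have := measurable_xsection (w : sub_space Y A) mC; rewrite /xsection.
  rewrite (_ : [set y | (w, y) \in [set z | C z.1 z.2]] = [set w' | C w w']).
    exact: (sub_space_measurable indepY).
  by apply/seteqP; split=> w' /=; rewrite inE.
have mC1 : measurable [set w | C w w].
  have mU : measurable_fun setT (id : Omega -> sub_space Y A).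
    exact: (sub_space_id_measurable indepY).
  have mV : measurable_fun setT (id : Omega -> sub_space Y B).
    exact: (sub_space_id_measurable indepY).
  have /(_ measurableT _ mC) := measurable_fun_pair mU mV.
  by rewrite setTI.
pose f (z : Omega * Omega) : \bar R := (\1_[set z : Omega * Omega | C z.1 z.2] z)%:E.
rewrite -integral_indic_probability //; transitivity (\int[P]_w f (w, w))%E.
  apply: eq_integral => w _; rewrite /f !indicE.
  suff -> : (w \in [set w | C w w]) = ((w, w) \in [set z | C z.1 z.2]) by [].
  by apply/idP/idP; rewrite !inE.
rewrite (integral_sub_space_decouple indepY AB).
- by apply: eq_integral => w _; rewrite -integral_indic_probability.
- exact/measurable_EFinP/measurable_indic.
- by move=> z; rewrite lee_fin.
Qed.

End probability_decouple.

Section measurable_decouple.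
Context {d : measure_display} {Omega : measurableType d} {R : realType}.
Context {I : eqType} (P : probability Omega R) (Y : I -> Omega -> R).
Hypothesis indepY : mutually_independent P Y.

Lemma measurable_probability_section (A B : set I) (C : Omega -> Omega -> Prop) :
  @measurable _ (sub_space Y A * sub_space Y B)%type [set z | C z.1 z.2] ->
  measurable_fun setT (fun w => P [set w' | C w w']).
Proof.
move=> mC.
have mU : measurable_fun setT (id : Omega -> sub_space Y A).
  exact: (sub_space_id_measurable indepY).
have mV : measurable_fun setT (id : Omega -> sub_space Y B).
  exact: (sub_space_id_measurable indepY).
pose iB : {mfun Omega >-> sub_space Y B} := mfun_Sub (mem_set mV).
pose PB := distribution P iB.
have := measurableT_comp (measurable_fun_xsection PB mC) mU.
congr (measurable_fun _ _); apply/funext => w /=.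
rewrite /PB /distribution /pushforward /=; congr (P _).
by apply/seteqP; split=> w' /=; rewrite /xsection /= inE.
Qed.

End measurable_decouple.

Section probability_lemmas.
Context {d : measure_display} {Omega : measurableType d} {R : realType}.
Variable P : probability Omega R.

Lemma probability_ae_le (A B : set Omega) : measurable A -> measurable B ->
  {ae P, forall w, A w -> B w} -> (P A <= P B)%E.
Proof.
move=> mA mB [N [mN PN0 AB]].
apply: (@le_trans _ _ (P (B `|` N))).
  apply: le_measure; rewrite ?inE //; first exact: measurableU.
  move=> w Aw; have [Bw|nBw] := pselect (B w); [by left|right].
  by apply: AB => /(_ Aw).
by apply: (le_trans (probability_setU_le _ _ _)) => //; rewrite PN0 adde0.
Qed.

Lemma probability_ae_eq (A B : set Omega) : measurable A -> measurable B ->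
  {ae P, forall w, A w <-> B w} -> P A = P B.
Proof.
move=> mA mB AB; apply/eqP; rewrite eq_le; apply/andP; split.
  by apply: probability_ae_le => //; apply: filterS AB => w [].
by apply: probability_ae_le => //; apply: filterS AB => w [].
Qed.

(** Needed for every Borel [A], since it is applied to the set of first interarrival times for which
    a server delivers nothing. Open rays form a pi-system on which it reduces to the
    multiplicativity of [surv]. *)
Lemma exp_distributed_memoryless (r c : R) (Z : Omega -> R) (A : set R) :
  exp_distributed P r Z -> 0 <= c -> measurable A ->
  P [set w | c < Z w /\ A (Z w - c)] = ((surv r c)%:E * P [set w | A (Z w)])%E.
Proof.
move=> expZ c0 mA; have mZ := expZ.1.
have mZc : measurable_fun setT (fun w => Z w - c) by exact: measurable_funB.
have mcZ : measurable [set w | c < Z w] by exact: measurable_set_lt.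
pose f1 : {measure set R -> \bar R} :=
  pushforward (mrestr P mcZ) (fun w => Z w - c).
pose f2 : {measure set R -> \bar R} :=
  pushforward P Z.
pose m1 := f1 mZc.
pose m2 : {measure set R -> \bar R} := mscale (NngNum (surv_ge0 r c)) (f2 mZ).
have m2E B : m2 B = ((surv r c)%:E * P [set w | B (Z w)])%E by [].
have m1E B : m1 B = P [set w | c < Z w /\ B (Z w - c)].
  by rewrite /m1 /f1 /pushforward /= /mrestr; congr (P _); apply/seteqP; split=> w [].
rewrite -m1E -m2E.
have m1T : m1 setT = (surv r c)%:E.
  by rewrite m1E -(exp_distributed_gt expZ); congr (P _); apply/seteqP; split=> w [].
have GT : [set X | @RGenOInfty.G R X /\ X `<=` setT] = @RGenOInfty.G R.
  by apply/seteqP; split=> X // -[].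
apply: (g_sigma_algebra_measure_unique_trace (@RGenOInfty.G R) setT) => //.
- by move=> X [[y ->] _].
- move=> X Z' [[y ->] _] [[z ->] _]; split => //; exists (Num.max y z).
  by apply/seteqP; split=> u /=; rewrite !in_itv /= !andbT gt_max;
    [case=> -> ->|move=> /andP].
- rewrite m1T m2E (_ : [set w | setT (Z w)] = setT) ?probability_setT ?mule1 //.
- move=> X [[y ->] _]; rewrite m1E m2E.
  have -> : [set w | `]y, +oo[%classic (Z w)] = [set w | y < Z w].
    by apply/seteqP; split=> w /=; rewrite in_itv /= andbT.
  have -> : [set w | c < Z w /\ `]y, +oo[%classic (Z w - c)] =
            [set w | c + Num.max 0 y < Z w].
    apply/seteqP; split=> w /=; rewrite in_itv /= andbT -ltrBrDl gt_max subr_gt0.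
      by case=> -> ->.
    by move=> /andP.
  rewrite !(exp_distributed_gt expZ) -EFinM; congr EFin.
  have m0 : 0 <= Num.max 0 y by rewrite le_max lexx.
  rewrite {1}/surv max_r ?addr_ge0 // mulrDr expRD.
  by rewrite (surv_pos _ c0).
- by rewrite m1T ltry.
- rewrite GT; change ((@RGenOInfty.G R).-sigma.-measurable A).
  by rewrite -RGenOInfty.measurableE; exact: mA.
Qed.

End probability_lemmas.

(** * A server that has just received an update *)

Section server.
Context {d : measure_display} {Omega : measurableType d} {R : realType}.
Variables (P : probability Omega R) (n : nat) (lam mu : 'I_n -> R).
Variables (X S : 'I_n -> nat -> Omega -> R).
Hypotheses (expX : forall j k, exp_distributed P (lam j) (X j k)).
Hypotheses (expS : forall j k, exp_distributed P (mu j) (S j k)).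
Let Y := all_times X S.
Hypothesis indepY : mutually_independent P Y.

Let index : eqType := (('I_n * nat) + ('I_n * nat))%type.

(** The times that decide what happens after update k has arrived: its service time counts, the
    interarrival time that precedes it does not. That time, [X j k], lies neither in [past j k] nor
    in [future j k]; it is the interval that straddles the present. *)
Definition future (j : 'I_n) (k : nat) : set index := fun z =>
  match z with
  | inl (i, m) => i = j /\ (k < m)%N
  | inr (i, m) => i = j /\ (k <= m)%N
  end.

Definition past (j : 'I_n) (k : nat) : set index := fun z =>
  match z with inl (i, m) | inr (i, m) => i = j /\ (m < k)%N end.

Local Notation arr j k := ([set inl (j, k)] : set index).
Local Notation srv j k := ([set inr (j, k)] : set index).

Lemma measurable_X (A : set index) j k : A (inl (j, k)) ->
  measurable_fun setT (X j k : sub_space Y A -> R).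
Proof. exact: (@sub_space_measurable_fun _ _ _ _ Y A (inl (j, k))). Qed.

Lemma measurable_S (A : set index) j k : A (inr (j, k)) ->
  measurable_fun setT (S j k : sub_space Y A -> R).
Proof. exact: (@sub_space_measurable_fun _ _ _ _ Y A (inr (j, k))). Qed.

Lemma measurable_X1 (A B : set index) j k : A (inl (j, k)) ->
  @measurable_fun _ _ (sub_space Y A * sub_space Y B)%type R setT
    (fun z => X j k z.1).
Proof. by move=> Ajk; exact: (measurableT_comp (measurable_X Ajk) measurable_fst). Qed.

Lemma measurable_X2 (A B : set index) j k : B (inl (j, k)) ->
  @measurable_fun _ _ (sub_space Y A * sub_space Y B)%type R setT
    (fun z => X j k z.2).
Proof. by move=> Bjk; exact: (measurableT_comp (measurable_X Bjk) measurable_snd). Qed.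

Lemma measurable_S1 (A B : set index) j k : A (inr (j, k)) ->
  @measurable_fun _ _ (sub_space Y A * sub_space Y B)%type R setT
    (fun z => S j k z.1).
Proof. by move=> Ajk; exact: (measurableT_comp (measurable_S Ajk) measurable_fst). Qed.

Lemma measurable_S2 (A B : set index) j k : B (inr (j, k)) ->
  @measurable_fun _ _ (sub_space Y A * sub_space Y B)%type R setT
    (fun z => S j k z.2).
Proof. by move=> Bjk; exact: (measurableT_comp (measurable_S Bjk) measurable_snd). Qed.

Lemma times_ge0_ae :
  {ae P, forall w, forall j k, 0 <= X j k w /\ 0 <= S j k w}.
Proof.
apply: filter_forall => j; apply: ae_foralln => k.
apply: filterS2 (exp_distributed_ge0 (expX j k)) (exp_distributed_ge0 (expS j k)).
by move=> w.
Qed.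

Lemma mX j k : measurable_fun setT (X j k). Proof. exact: (expX j k).1. Qed.
Lemma mS j k : measurable_fun setT (S j k). Proof. exact: (expS j k).1. Qed.
#[local] Hint Resolve mX mS : core.

Lemma measurable_trunc_undel_in (A : set index) j K k b : future j k `<=` A ->
  measurable ([set w | trunc_undel (X j ^~ w) (S j ^~ w) K k b] :
    set (sub_space Y A)).
Proof.
move=> fA; apply: (@measurable_trunc_undel _ _ (sub_space Y A) (X j) (S j) (cst b)) => //.
- by move=> i ki; apply: measurable_X; apply: fA.
- by move=> i ki; apply: measurable_S; apply: fA.
Qed.

Lemma probability_service_gap j k b c : 0 <= c ->
  P [set w | S j k w < c -> b < S j k w] =
  (if c <= b then surv (mu j) c else surv (mu j) b)%:E.
Proof.
move=> c0; have [cb|bc] := leP c b.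
  rewrite (_ : [set _ | _] = ~` [set w | S j k w < c]).
    rewrite probability_setC; last by apply: measurable_set_lt.
    by rewrite (exp_distributed_lt (expS j k)) -EFinB opprB addrC subrK.
  apply/seteqP; split=> w /= h sc; last by [].
  by have := h sc; rewrite ltNge (le_trans (ltW sc) cb).
rewrite -(exp_distributed_gt (expS j k)); congr (P _); apply/seteqP; split=> w //= h.
by have [/h//|cs] := ltP (S j k w) c; exact: lt_le_trans bc cs.
Qed.

(** Condition on the next interarrival time c. If c <= b, the current service contributes [surv c]
    and the following ones [surv (b - c)], whose product is [surv b]. If c > b, only the current
    service matters. Either way the answer is the same as without preemption. *)
Lemma probability_trunc_undel j K k b :
  P [set w | trunc_undel (X j ^~ w) (S j ^~ w) K k b] = (surv (mu j) b)%:E.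
Proof.
elim: K k b => [|K IH] k b /=; first exact: (exp_distributed_gt (expS j k) b).
(* The almost sure condition [0 <= X j k.+1 w] is put into the event because
   [probability_service_gap] requires a nonnegative c. *)
pose C w w' := 0 <= X j k.+1 w /\ ((S j k w' < X j k.+1 w -> b < S j k w') /\
  trunc_undel (X j ^~ w') (S j ^~ w') K k.+1 (b - X j k.+1 w)).
pose B := srv j k `|` future j k.+1.
have AB : arr j k.+1 `&` B = set0.
  by rewrite -subset0 => z [/= -> [//|[_]]]; rewrite ltnn.
have SB : B (inr (j, k)) by left.
have fB : future j k.+1 `<=` B by move=> z; right.
transitivity (P [set w | C w w]).
  apply: probability_ae_eq.
  - apply: (@measurable_trunc_undel _ _ _ (X j) (S j) (cst b) K.+1 k) => //.
  - apply: measurable_set_and; first exact: measurable_set_le.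
    exact: (@measurable_trunc_undel _ _ _ (X j) (S j) (cst b) K.+1 k).
  - by apply: filterS times_ge0_ae => w h; split=> [|[]//]; split=> //; apply: (h _ _).1.
rewrite (probability_decouple indepY AB); last first.
  have mX1 := @measurable_X1 (arr j k.+1) B j k.+1 erefl.
  have mS2 := @measurable_S2 (arr j k.+1) B j k SB.
  apply: measurable_set_and; first exact: measurable_set_le.
  apply: measurable_set_and.
    by apply: measurable_set_imply; exact: measurable_set_lt.
  apply: (@measurable_trunc_undel _ _ (sub_space Y (arr j k.+1) * sub_space Y B)%type
    (fun i z => X j i z.2)
    (fun i z => S j i z.2) (fun z => b - X j k.+1 z.1)).
  - by apply: measurable_funB.
  - by move=> i ki; apply: measurable_X2; apply: fB.
  - by move=> i ki; apply: measurable_S2; apply: fB.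
transitivity (\int[P]_w ((surv (mu j) b)%:E * (\1_[set w | 0 <= X j k.+1 w] w)%:E))%E.
  apply: eq_integral => w _; rewrite /C indicE.
  have [c0|c0] := leP 0 (X j k.+1 w); last first.
    rewrite memNset /= ?mule0; last by rewrite leNgt c0.
    by rewrite (_ : [set _ | _] = set0) ?measure0 // -subset0 => w' [].
  rewrite mem_set // mule1; set c := X j k.+1 w in c0 *.
  transitivity (P ([set w' | S j k w' < c -> b < S j k w'] `&`
     [set w' | trunc_undel (X j ^~ w') (S j ^~ w') K k.+1 (b - c)])).
    by congr (P _); apply/seteqP; split=> w' [//].
  rewrite (sub_space_indep indepY (A := srv j k) (B := future j k.+1)).
  - rewrite probability_service_gap // IH -EFinM; congr EFin; case: leP => cb.
      by rewrite !surv_pos ?subr_ge0 ?(le_trans c0) // -expRD; congr expR; ring.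
    by rewrite (surv_neg _ (b := b - c)) ?mulr1 // subr_le0 ltW.
  - by rewrite -subset0 => z [/= ->] [_]; rewrite ltnn.
  - apply: measurable_set_imply; apply: measurable_set_lt => //;
    exact: (measurable_S (A := srv j k) erefl).
  - exact: measurable_trunc_undel_in.
rewrite ge0_integralZl ?lee_fin ?surv_ge0 //; last first.
  exact/measurable_EFinP/measurable_indic/measurable_set_le.
rewrite integral_indic_probability; last exact: measurable_set_le.
suff -> : P [set w | 0 <= X j k.+1 w] = 1%E by rewrite mule1.
rewrite (probability_ae_eq (B := setT)) ?probability_setT //.
  exact: measurable_set_le.
by apply: filterS times_ge0_ae => w h; split=> // _; exact: (h _ _).1.
Qed.

End server.

(** Turns a truncation error valid at every level K into an exact equality. *)
Lemma geometric_dist_eq {R : realType} (x y q : R) : 0 <= q < 1 ->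
  (forall K, `|x - y| <= q ^+ K) -> x = y.
Proof.
move=> /andP[q0 q1] h; apply/eqP; rewrite -subr_eq0 -normr_le0.
have c0 : q ^+ K @[K --> \oo] --> 0 by apply: cvg_expr; rewrite ger0_norm.
rewrite -(cvg_lim (@Rhausdorff R) c0); apply: limr_ge.
  by apply/cvg_ex; exists 0.
by apply: nearW => K; exact: h.
Qed.

(** * A server that starts empty, and its restart at a fixed time *)

Section server_markov.
Context {d : measure_display} {Omega : measurableType d} {R : realType}.
Variables (P : probability Omega R) (n : nat) (lam mu : 'I_n -> R).
Variables (X S : 'I_n -> nat -> Omega -> R).
Hypothesis lam_gt0 : forall j, 0 < lam j.
Hypotheses (expX : forall j k, exp_distributed P (lam j) (X j k)).
Hypotheses (expS : forall j k, exp_distributed P (mu j) (S j k)).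
Let Y := all_times X S.
Hypothesis indepY : mutually_independent P Y.
Let index : eqType := (('I_n * nat) + ('I_n * nat))%type.
Let mX j k : measurable_fun setT (X j k). Proof. exact: (expX j k).1. Qed.
Let mS j k : measurable_fun setT (S j k). Proof. exact: (expS j k).1. Qed.
#[local] Hint Resolve mX mS : core.
Local Notation arr j k := ([set inl (j, k)] : set index).
Let ge0 := times_ge0_ae expX expS.

Let mundel j k (b : R) : measurable [set w | undel (X j ^~ w) (S j ^~ w) k b].
Proof. exact: (@measurable_undel _ _ _ (X j) (S j) (cst b)). Qed.

Let mtrunc j K k b : measurable [set w | trunc_undel (X j ^~ w) (S j ^~ w) K k b].
Proof. exact: (@measurable_trunc_undel _ _ _ (X j) (S j) (cst b)). Qed.

Lemma probability_all_small j k K b :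
  P (\bigcap_(i < K) [set w | X j (k + i).+1 w <= b]) =
  ((1 - surv (lam j) b) ^+ K)%:E.
Proof.
pose g (i : nat) : index := inl (j, (k + i).+1).
have gI : injective g by move=> a c [/eqP]; rewrite eqn_add2l => /eqP.
have := indepY.2 (map g (iota 0 K)) (fun=> [set x | x <= b]).
rewrite map_inj_uniq // iota_uniq => /(_ isT) h.
transitivity (P (\bigcap_(i in [set` [seq g i | i <- iota 0 K]])
   Y i @^-1` [set x | x <= b])).
  congr (P _); apply/seteqP; split=> w /= h' i.
    by move=> /mapP[m]; rewrite mem_iota /= => mK ->; exact: h'.
  move=> /= iK; apply: (h' (g i)); apply/mapP; exists i => //.
  by rewrite mem_iota.
rewrite h; last by move=> _; rewrite (_ : [set x | x <= b] = `]-oo, b]%classic) //;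
  apply/seteqP; split=> x /=; rewrite in_itv.
rewrite big_map -[K in RHS]subn0 -prodr_const_nat -prodEFin /index_iota subn0.
by apply: eq_bigr => i _; rewrite -(exp_distributed_le (expX j (k + i).+1)).
Qed.

(** The truncated event differs from the true one only if the next K interarrival times are all at
    most [b], since one longer interval already pushes the truncation beyond the horizon. This has
    probability [(1 - surv (lam j) b) ^+ K]. *)
Lemma probability_undel j k (b : R) :
  P [set w | undel (X j ^~ w) (S j ^~ w) k b] = (surv (mu j) b)%:E.
Proof.
set U := [set w | _].
rewrite -[LHS]fineK ?fin_num_measure //; last exact: mundel.
congr EFin; apply: (@geometric_dist_eq _ _ _ (1 - surv (lam j) b)).
  by rewrite subr_ge0 surv_le1 //= gtrBl expR_gt0.
move=> K; set q := 1 - _.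
set T := [set w | trunc_undel (X j ^~ w) (S j ^~ w) K k b].
set N := \bigcap_(i < K) [set w | X j (k + i).+1 w <= b].
have mN : measurable N.
  by apply: bigcap_measurableType => i _; exact: measurable_set_le.
have PT : P T = (surv (mu j) b)%:E.
  exact: (probability_trunc_undel expX expS indepY).
have PN : P N = (q ^+ K)%:E by exact: probability_all_small.
have UT : {ae P, forall w, ~ N w -> (T w <-> U w)}.
  apply: filterS ge0 => w h nN; apply: trunc_undelE => [i|i|].
  - exact: (h _ _).1.
  - exact: (h _ _).2.
  have [i iK bi] : exists2 i, (i < K)%N & b < X j (k + i).+1 w.
    apply: contrapT => nex; apply: nN => i /= iK; rewrite leNgt; apply/negP => bi.
    by apply: nex; exists i.
  apply: (lt_le_trans bi); rewrite (bigD1 (Ordinal iK)) //= lerDl.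
  by apply: sumr_ge0 => m _; exact: (h _ _).1.
have mT : measurable T by exact: mtrunc.
have mU : measurable U by exact: mundel.
have H1 : (P U <= P T + P N)%E.
  apply: le_trans (probability_setU_le P mT mN).
  apply: probability_ae_le => //; first exact: measurableU.
  apply: filterS UT => w TU Uw; have [Nw|nN] := pselect (N w); [by right|left].
  exact/(TU nN).
have H2 : (P T <= P U + P N)%E.
  apply: le_trans (probability_setU_le P mU mN).
  apply: probability_ae_le => //; first exact: measurableU.
  apply: filterS UT => w TU Uw; have [Nw|nN] := pselect (N w); [by right|left].
  exact/(TU nN).
move: H1 H2; rewrite PT PN -[P U]fineK ?fin_num_measure // -!EFinD !lee_fin.
by rewrite ler_distl lerBlDr => -> ->.
Qed.

(* P(no delivery within b), the server being empty at time 0 *)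
Definition idle (j : 'I_n) (b : R) : R :=
  fine (P [set w | undel (X j ^~ w) (S j ^~ w) 0 (b - X j 0%N w)]).

Let law_shift j k (b : R) :
  P [set w | undel (X j ^~ w) (S j ^~ w) k (b - X j k w)] =
  (\int[P]_w (surv (mu j) (b - X j k w)%R)%:E)%E.
Proof.
pose C (w w' : Omega) := undel (X j ^~ w') (S j ^~ w') k (b - X j k w).
have AB : arr j k `&` future j k = set0.
  by rewrite -subset0 => z [/= -> [_]]; rewrite ltnn.
rewrite (probability_decouple indepY AB (C := C)).
  by apply: eq_integral => w _; rewrite -(probability_undel j k).
apply: (@measurable_undel _ _ (sub_space Y (arr j k) * sub_space Y (future j k))%type
    (fun i z => X j i z.2) (fun i z => S j i z.2)).
- by apply: measurable_funB => //; exact: measurable_X1.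
- by move=> i ki; apply: measurable_X2.
- by move=> i ki; apply: measurable_S2.
Qed.

(** By [law_shift] the left side depends only on the law of [X j k], which is the same for all k. So
    waiting for update k from an empty server is like waiting for the first one. *)
Lemma idleE j k (b : R) :
  P [set w | undel (X j ^~ w) (S j ^~ w) k (b - X j k w)] = (idle j b)%:E.
Proof.
have mf : measurable_fun setT (fun x : R => (surv (mu j) (b - x))%:E).
  apply/measurable_EFinP/(measurableT_comp (measurable_surv (mu j))).
  exact: measurable_funB.
have E m : (\int[P]_w (surv (mu j) (b - X j m w)%R)%:E =
    \int[distribution P (mfun_Sub (mem_set (mX j m)) : {mfun Omega >-> R})]_x
      (surv (mu j) (b - x)%R)%:E)%E.
  by rewrite ge0_integral_distribution // => x; rewrite lee_fin surv_ge0.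
rewrite /idle fineK.
  rewrite !law_shift !E; apply: eq_measure_integral => A mA _.
  transitivity (exponential_prob (lam j) A); first exact: (expX j _).2.
  by apply/esym; exact: (expX j _).2.
apply: fin_num_measure; apply: (@measurable_undel _ _ _ (X j) (S j)) => //.
exact: measurable_funB.
Qed.

(** Given that update k has not come during c time units, the rest of its interarrival time is a
    fresh exponential one, so the server behaves as one that is empty now. *)
Lemma probability_idle_init j k (b c : R) : 0 <= c ->
  P [set w | c < X j k w /\ undel (X j ^~ w) (S j ^~ w) k (b + c - X j k w)] =
  (surv (lam j) c * idle j b)%:E.
Proof.
move=> c0.
pose C c (w w' : Omega) := c < X j k w' /\
  undel (X j ^~ w) (S j ^~ w) k (b + c - X j k w').
pose D (w w' : Omega) := undel (X j ^~ w) (S j ^~ w) k (b - X j k w').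
have AB : future j k `&` arr j k = set0.
  by rewrite -subset0 => z [h /= E]; move: h; rewrite E => -[_]; rewrite ltnn.
have mX2 := @measurable_X2 _ _ _ _ X S (future j k) (arr j k) j k erefl.
have mD c' : @measurable _ (sub_space Y (future j k) * sub_space Y (arr j k))%type
    [set z | undel (X j ^~ z.1) (S j ^~ z.1) k (b + c' - X j k z.2)].
  apply: (@measurable_undel _ _ (sub_space Y (future j k) * sub_space Y (arr j k))%type
    (fun i z => X j i z.1) (fun i z => S j i z.1)).
  - exact: measurable_funB.
  - by move=> i ki; apply: measurable_X1.
  - by move=> i ki; apply: measurable_S1.
rewrite (probability_decouple indepY AB (C := C c)); last first.
  by apply: measurable_set_and; [exact: measurable_set_lt|exact: mD].
have {}mD : @measurable _ (sub_space Y (future j k) * sub_space Y (arr j k))%type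
    [set z | D z.1 z.2] by have := mD 0; rewrite addr0.
rewrite EFinM -(idleE j k) (probability_decouple indepY AB mD).
rewrite -ge0_integralZl ?lee_fin ?surv_ge0 //; last first.
  exact: (measurable_probability_section indepY mD).
apply: eq_integral => w _.
rewrite -(exp_distributed_memoryless (A := [set y | undel (X j ^~ w) (S j ^~ w) k (b - y)])
  (expX j k)) //.
  by congr (P _); apply/seteqP; split=> w' [h1] /= h2; split=> //;
    move: h2; rewrite opprB addrA.
apply: (@measurable_undel _ _ R (fun i _ => X j i w) (fun i _ => S j i w)) => //.
exact: measurable_funB.
Qed.

(* Markov property at a fixed time t: an event determined by the updates that
   arrived before t is independent of the deliveries of the later ones. *)
Lemma server_markov j k (F : set Omega) (t b : R) :
  measurable (F : set (sub_space Y (past j k))) ->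
  P [set w | F w /\ (\sum_(i < k) X j i w <= t < \sum_(i < k.+1) X j i w /\
     undel (X j ^~ w) (S j ^~ w) k (b + t - \sum_(i < k.+1) X j i w))] =
  (P [set w | F w /\ (\sum_(i < k) X j i w <= t < \sum_(i < k.+1) X j i w)%R]
   * (idle j b)%:E)%E.
Proof.
move=> mF; pose V w := \sum_(i < k) X j i w.
(* With the past frozen at [w], the wait for update k has already lasted [t - V w];
   [probability_idle_init] is applied with this elapsed time. *)
pose C (w w' : Omega) := (F w /\ V w <= t) /\ (t - V w < X j k w' /\
  undel (X j ^~ w') (S j ^~ w') k (b + (t - V w) - X j k w')).
pose D (w w' : Omega) := (F w /\ V w <= t) /\ t - V w < X j k w'.
pose A := past j k; pose B : set index := arr j k `|` future j k.
have AB : A `&` B = set0.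
  rewrite -subset0 => -[[i m]|[i m]] [[/= _ mk]] [|].
  - by case=> _ /eqP; rewrite (ltn_eqF mk).
  - by case=> _ /(ltn_trans mk); rewrite ltnn.
  - by [].
  - by case=> _ /(leq_trans mk); rewrite ltnn.
have mV : @measurable_fun _ _ (sub_space Y A * sub_space Y B)%type R setT
    (fun z => V z.1).
  by apply: measurable_sum => i; apply: measurable_X1; split=> //; exact: ltn_ord.
have mtV : @measurable_fun _ _ (sub_space Y A * sub_space Y B)%type R setT
    (fun z => t - V z.1) by exact: measurable_funB.
have mX2 : @measurable_fun _ _ (sub_space Y A * sub_space Y B)%type R setT
    (fun z => X j k z.2) by apply: measurable_X2; left.
have mFV : @measurable _ (sub_space Y A * sub_space Y B)%type
    [set z | F z.1 /\ V z.1 <= t].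
  apply: measurable_set_and; last exact: measurable_set_le.
  by have := @measurable_fst _ _ (sub_space Y A) (sub_space Y B) measurableT F mF;
    rewrite setTI.
have mD : @measurable _ (sub_space Y A * sub_space Y B)%type [set z | D z.1 z.2].
  by apply: measurable_set_and => //; exact: measurable_set_lt.
have mC : @measurable _ (sub_space Y A * sub_space Y B)%type [set z | C z.1 z.2].
  apply: measurable_set_and => //; apply: measurable_set_and.
    exact: measurable_set_lt.
  apply: (@measurable_undel _ _ (sub_space Y A * sub_space Y B)%type
    (fun i z => X j i z.2) (fun i z => S j i z.2)).
  - by apply: measurable_funB => //; exact: measurable_funD.
  - by move=> i ki; apply: measurable_X2; right.
  - by move=> i ki; apply: measurable_S2; right.
transitivity (P [set w | C w w]).
  congr (P _); apply/seteqP; split=> w; rewrite /C /V /= big_ord_recr /= ltrBlDl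
    -[b + (t - _) - _]addrA -[b + t - _]addrA -[t - _ - _]addrA -opprD.
    by case=> Fw [/andP[h1 h2] h3].
  by case=> -[Fw h1] [h2 h3]; rewrite h1.
transitivity (P [set w | D w w] * (idle j b)%:E)%E; last first.
  congr (P _ * _)%E; apply/seteqP; split=> w; rewrite /D /V /= big_ord_recr /=.
    by case=> -[Fw h1]; rewrite ltrBlDl h1.
  by case=> Fw /andP[h1 h2]; rewrite ltrBlDl.
rewrite (probability_decouple indepY AB mC) (probability_decouple indepY AB mD).
rewrite muleC -ge0_integralZl //; last 2 first.
- exact: (measurable_probability_section indepY mD).
- by rewrite lee_fin fine_ge0.
apply: eq_integral => w _; rewrite /C /D.
have [FV|nFV] := pselect (F w /\ V w <= t); last first.
  rewrite (_ : [set _ | _] = set0); last by rewrite -subset0 => w' [].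
  rewrite (_ : [set _ | _ /\ _] = set0); last by rewrite -subset0 => w' [].
  by rewrite measure0 mule0.
have tV : 0 <= t - V w by rewrite subr_ge0; case: FV.
transitivity (surv (lam j) (t - V w) * idle j b)%:E.
  rewrite -(probability_idle_init j k b tV).
  by congr (P _); apply/seteqP; split=> w' //= -[].
rewrite EFinM muleC -(exp_distributed_gt (expX j k)).
by congr (_ * P _)%E; apply/seteqP; split=> w' //= -[].
Qed.

Lemma idle_ge0 j b : 0 <= idle j b.
Proof. by rewrite fine_ge0. Qed.

End server_markov.

(** * Deliveries in windows of time *)

Section server_deliveries.
Context {d : measure_display} {Omega : measurableType d} {R : realType}.
Variables (P : probability Omega R) (n : nat) (lam mu : 'I_n -> R).
Variables (X S : 'I_n -> nat -> Omega -> R).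
Hypothesis lam_gt0 : forall j, 0 < lam j.
Hypotheses (expX : forall j k, exp_distributed P (lam j) (X j k)).
Hypotheses (expS : forall j k, exp_distributed P (mu j) (S j k)).
Let Y := all_times X S.
Hypothesis indepY : mutually_independent P Y.
Let index : eqType := (('I_n * nat) + ('I_n * nat))%type.
Let mX j k : measurable_fun setT (X j k). Proof. exact: (expX j k).1. Qed.
Let mS j k : measurable_fun setT (S j k). Proof. exact: (expS j k).1. Qed.
#[local] Hint Resolve mX mS : core.
Let ge0 := times_ge0_ae expX expS.

(* every update of server j delivered by time t was generated by time tau *)
Definition stale (j : 'I_n) (t tau : R) (w : Omega) : Prop := forall m,
  delivered X S j m w -> arrival X j m w + S j m w <= t -> arrival X j m w <= tau.

Let epoch j k tau (w : Omega) : Prop :=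
  \sum_(i < k) X j i w <= tau < \sum_(i < k.+1) X j i w.

Let arrivals_mono j w m k : (forall j k, 0 <= X j k w /\ 0 <= S j k w) ->
  (m <= k)%N -> \sum_(i < m) X j i w <= \sum_(i < k) X j i w.
Proof.
move=> h mk; rewrite -(subnKC mk) big_split_ord /= lerDl.
by apply: sumr_ge0 => i _; exact: (h _ _).1.
Qed.

(** In epoch k the updates generated after [tau] are exactly those of index at least k, so staleness
    says that none of them is delivered by [t]. *)
Let stale_future j k t tau w : (forall j k, 0 <= X j k w /\ 0 <= S j k w) ->
  epoch j k tau w -> stale j t tau w <->
    undel (X j ^~ w) (S j ^~ w) k (t - \sum_(i < k.+1) X j i w).
Proof.
move=> h /andP[kt tk].
have AE m : arrival X j (k + m) w =
    \sum_(i < k.+1) X j i w + \sum_(i < m) X j (k + i).+1 w.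
  by rewrite /arrival -addSn big_split_ord.
split=> [st m sx|un m dm].
  have := st (k + m)%N sx; rewrite AE ltrBlDl addrA; apply: contraPT.
  rewrite -leNgt => le_t /(_ le_t); apply/negP; rewrite -ltNge.
  apply: (lt_le_trans tk); rewrite lerDl.
  by apply: sumr_ge0 => i _; exact: (h _ _).1.
have [mk|km] := ltnP m k.
  by move=> _; apply: le_trans kt; exact: arrivals_mono.
move: dm; rewrite -(subnKC km) => /un; rewrite ltrBlDl addrA -AE => lt_t le_t.
by move: (lt_le_trans lt_t le_t); rewrite ltxx.
Qed.

(** Whether update k - 1 is preempted depends on [X j k], which is outside [past j k]. The delivery
    test is therefore dropped for that one update: in epoch k, a service of it that ends by
    [s <= tau] ends before the arrival of update k anyway. *)
Let past_stale j k s sig (w : Omega) : Prop := forall m, (m < k)%N ->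
  ((m.+1 < k)%N -> delivered X S j m w) ->
  arrival X j m w + S j m w <= s -> arrival X j m w <= sig.

Let stale_past j k s sig tau w : (forall j k, 0 <= X j k w /\ 0 <= S j k w) ->
  s <= tau -> epoch j k tau w -> stale j s sig w <-> past_stale j k s sig w.
Proof.
move=> h st /andP[kt tk]; split=> [sw m mk dm ms|pw m dm ms].
  apply: sw => //; have [/dm //|km] := ltnP m.+1 k.
  have {km mk}E : k = m.+1 by apply/eqP; rewrite eqn_leq km.
  move: tk; rewrite E big_ord_recr /=; rewrite -/(arrival X j m w) => tk.
  have := le_lt_trans (le_trans ms st) tk.
  by rewrite ltrD2l.
apply: pw => //; rewrite ltnNge; apply/negP => km.
have km1 : (k.+1 <= m.+1)%N by [].
have := lt_le_trans tk (arrivals_mono j h km1); rewrite -/(arrival X j m w) => tA.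
have := lt_le_trans tA (le_trans _ (le_trans ms st)).
by rewrite lerDl ltxx => /(_ (h _ _).2).
Qed.

Let measurable_arrival (A : set index) j m : (forall i, (i <= m)%N -> A (inl (j, i))) ->
  measurable_fun setT (arrival X j m : sub_space Y A -> R).
Proof.
by move=> Aj; apply: measurable_sum => i; apply: measurable_X; apply: Aj;
   exact: (ltn_ord i).
Qed.

Definition server_of (j : 'I_n) : set index := fun z =>
  match z with inl (i, _) | inr (i, _) => i = j end.

Lemma measurable_stale_in (A : set index) j (t tau : R) : server_of j `<=` A ->
  measurable (stale j t tau : set (sub_space Y A)).
Proof.
move=> jA; have mXA i : measurable_fun setT (X j i : sub_space Y A -> R).
  by apply: measurable_X; apply: jA.
have mSA i : measurable_fun setT (S j i : sub_space Y A -> R).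
  by apply: measurable_S; apply: jA.
have mA m : measurable_fun setT (arrival X j m : sub_space Y A -> R).
  by apply: measurable_arrival => i _; apply: jA.
apply: measurable_set_forall => m; apply: measurable_set_imply.
  exact: measurable_set_lt.
apply: measurable_set_imply; apply: measurable_set_le => //.
exact: measurable_funD.
Qed.

Lemma measurable_stale j (t tau : R) : measurable (stale j t tau).
Proof.
by apply: (sub_space_measurable indepY (A := server_of j)); exact: measurable_stale_in.
Qed.

Let measurable_past_stale j k (s sig : R) :
  measurable (past_stale j k s sig : set (sub_space Y (past j k))).
Proof.
apply: measurable_set_forall => m; have [mk|km] := ltnP m k; last first.
  rewrite (_ : [set _ | _] = setT) //.
  by apply/seteqP; split=> // w _ /=; rewrite ltnNge km.
have mA : measurable_fun setT (arrival X j m : sub_space Y (past j k) -> R).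
  by apply: measurable_arrival => i im; split=> //; exact: leq_ltn_trans im mk.
have mSm : measurable_fun setT (S j m : sub_space Y (past j k) -> R).
  exact: measurable_S.
apply: measurable_set_imply; first exact: measurable_set_cst.
apply: measurable_set_imply.
  have [m1k|km1] := boolP (m.+1 < k)%N; last first.
    by rewrite (_ : [set _ | _] = setT) //; apply/seteqP; split.
  apply: measurable_set_imply; first exact: measurable_set_cst.
  by apply: measurable_set_lt => //; exact: measurable_X.
apply: measurable_set_imply; apply: measurable_set_le => //.
exact: measurable_funD.
Qed.

Let measurable_epoch j k (tau : R) : measurable (epoch j k tau).
Proof.
have mB i : measurable_fun setT (fun w => \sum_(m < i) X j m w).
  by apply: measurable_sum => m.
rewrite (_ : epoch j k tau = [set w | \sum_(i < k) X j i w <= tau] `&`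
   [set w | tau < \sum_(i < k.+1) X j i w]).
  by apply: measurableI; [exact: measurable_set_le|exact: measurable_set_lt].
by apply/seteqP; split=> w /andP.
Qed.

Let epoch_disjoint j tau w k k' : (forall j k, 0 <= X j k w /\ 0 <= S j k w) ->
  epoch j k tau w -> epoch j k' tau w -> k = k'.
Proof.
move=> h; wlog kk' : k k' / (k <= k')%N => [wl|/andP[_ tk] /andP[kt' _]].
  by have [/wl//|/ltnW/wl H /H {}H /H] := leqP k k'.
apply/eqP; rewrite eqn_leq kk' leqNgt; apply/negP => lkk'.
by have := lt_le_trans tk (le_trans (arrivals_mono j h lkk') kt'); rewrite ltxx.
Qed.

Let epoch_exists j (tau : R) : 0 <= tau -> {ae P, forall w, exists k, epoch j k tau w}.
Proof.
(* Infinitely many arrivals before [tau] would force all interarrival times to be at most [tau], an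
   event below every power of a number less than 1. *)
move=> t0; pose N := \bigcap_(i in @setT nat) [set w | X j (0 + i).+1 w <= tau].
have mN : measurable N by apply: bigcapT_measurable => i; exact: measurable_set_le.
have PN : P N = 0%E.
  rewrite -[LHS]fineK ?fin_num_measure //; congr EFin.
  apply: (@geometric_dist_eq _ _ _ (1 - surv (lam j) tau)).
    by rewrite subr_ge0 surv_le1 //= gtrBl expR_gt0.
  move=> K; rewrite subr0 ger0_norm ?fine_ge0 // -lee_fin fineK ?fin_num_measure //.
  rewrite -(probability_all_small expX indepY j 0 K tau).
  apply: le_measure; rewrite ?inE //.
    by apply: bigcap_measurableType => i _; exact: measurable_set_le.
  by move=> w h i _; exact: h.
have : {ae P, forall w, ~ N w} by exists N; split=> // w /= /contrapT.
move=> nN; apply: filterS2 nN ge0 => w nN h.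
have [i ti] : exists i, tau < X j i.+1 w.
  apply: contrapT => nex; apply: nN => i _ /=; rewrite leNgt; apply/negP => ti.
  by apply: nex; exists i.
have ex : exists k, tau < \sum_(m < k) X j m w.
  exists i.+2; apply: (lt_le_trans ti); rewrite (bigD1 ord_max) //= lerDl.
  by apply: sumr_ge0 => m _; exact: (h _ _).1.
case: (ex_minnP ex) => -[|k] tk min; first by move: tk; rewrite big_ord0 ltNge t0.
exists k; rewrite /epoch tk andbT leNgt; apply/negP => /min.
by rewrite ltnn.
Qed.

Let probability_epochs j (tau : R) E : 0 <= tau -> measurable E ->
  P E = (\sum_(k <oo) P (E `&` epoch j k tau))%E.
Proof.
move=> t0 mE; pose F k := E `&` epoch j k tau.
have mF k : measurable (F k) by exact: measurableI.
(* Epochs are disjoint only where all times are nonnegative, that is almost surely; [seqDU] supplies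
   genuinely disjoint sets for sigma-additivity. *)
transitivity (P (\bigcup_k seqDU F k)).
  rewrite -seqDU_bigcup_eq; apply: probability_ae_eq => //.
    exact: bigcupT_measurable.
  have ee := epoch_exists j t0.
  by move: ee; apply: filterS => w [k wk]; split=> [Ew|[? _ []]//]; exists k.
transitivity (\sum_(k <oo) P (seqDU F k))%E.
  apply: measure_semi_bigcup => //; first exact: seqDU_measurable.
  by apply: bigcupT_measurable => k; exact: seqDU_measurable.
apply: eq_eseriesr => k _; apply: probability_ae_eq => //.
- exact: seqDU_measurable.
- exact: (mF k).
move: (ge0); apply: filterS => w h; rewrite /seqDU; split=> [[]//|Fw]; split=> //.
rewrite -bigcup_mkord => -[i /= ik [_ wi]].
by move: ik; rewrite (epoch_disjoint h wi Fw.2) ltnn.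
Qed.

(** Staleness at [(t, tau)] ignores any update in service at time [tau], so on each epoch it looks
    like an empty server started at [tau], independent of what was delivered by [s]. *)
Lemma probability_stale2 j (s sig t tau : R) : 0 <= tau -> s <= tau ->
  P (stale j s sig `&` stale j t tau) =
  (P (stale j s sig) * (idle P X S j (t - tau))%:E)%E.
Proof.
move=> t0 st; have mst := measurable_stale.
rewrite (probability_epochs j t0) ?(probability_epochs j t0 (mst j s sig));
  last exact: measurableI.
rewrite muleC -nneseriesZl; last by [].
apply: eq_eseriesr => k _.
have mpast := @measurable_past_stale j k s sig.
have mpast' := sub_space_measurable indepY mpast.
transitivity (P [set w | past_stale j k s sig w /\
   (\sum_(i < k) X j i w <= tau < \sum_(i < k.+1) X j i w /\
     undel (X j ^~ w) (S j ^~ w) k (t - tau + tau - \sum_(i < k.+1) X j i w))]).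
  apply: probability_ae_eq.
  - by apply: measurableI => //; exact: measurableI.
  - apply: measurable_set_and => //; apply: measurable_set_and; first exact: measurable_epoch.
    apply: (@measurable_undel _ _ _ (X j) (S j)) => //.
    by apply: measurable_funB => //; exact: measurable_sum.
  - move: (ge0); apply: filterS => w h; rewrite subrK; split.
      move=> [[w1 w2] we]; split; first exact/(stale_past sig h st we).
      by split=> //; exact/(stale_future t h we).
    move=> [w1 [we w2]]; do 2 split=> //; first exact/(stale_past sig h st we).
    exact/(stale_future t h we).
rewrite (server_markov lam_gt0 expX expS indepY) // muleC; congr (_ * _)%E.
apply: probability_ae_eq.
- by apply: measurable_set_and => //; exact: measurable_epoch.
- exact: measurableI.
- move: (ge0); apply: filterS => w h; split=> -[w1 we]; split=> //.
    exact/(stale_past sig h st we).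
  exact/(stale_past sig h st we).
Qed.

Lemma stale_refl j (t : R) : {ae P, forall w, stale j t t w}.
Proof.
move: (ge0); apply: filterS => w h m _; apply: le_trans.
by rewrite lerDl; exact: (h _ _).2.
Qed.

Lemma probability_stale j (t tau : R) : 0 <= tau ->
  P (stale j t tau) = (idle P X S j (t - tau))%:E.
Proof.
move=> t0; have mst := measurable_stale.
rewrite (probability_ae_eq (B := stale j tau tau `&` stale j t tau)) //.
- rewrite probability_stale2 // (probability_ae_eq (B := setT)) //.
    by rewrite probability_setT mul1e.
  by move: (stale_refl j tau); apply: filterS => w.
- exact: measurableI.
- by move: (stale_refl j tau); apply: filterS => w ?; split=> [|[]].
Qed.

(** No delivery within [a + b] implies no delivery within [a] and no delivery by [a + b] of an
    update generated after [a]; these two events are independent. This is the source of the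
    exponential tails. *)
Lemma idle_submul j (a b : R) : 0 <= a -> 0 <= b ->
  idle P X S j (a + b) <= idle P X S j a * idle P X S j b.
Proof.
move=> a0 b0; rewrite -lee_fin EFinM.
have -> : (idle P X S j (a + b))%:E = P (stale j (a + b) 0).
  by rewrite probability_stale // subr0.
have -> : (idle P X S j a)%:E = P (stale j a 0).
  by rewrite probability_stale // subr0.
have -> : idle P X S j b = idle P X S j (a + b - a) by rewrite addrC addKr.
rewrite -probability_stale2 //; apply: le_measure; rewrite ?inE.
- exact: measurable_stale.
- by apply: measurableI; exact: measurable_stale.
- move=> w h; split=> m dm mt.
    by apply: h => //; apply: le_trans mt _; rewrite lerDl.
  exact: le_trans (h _ dm mt) a0.
Qed.

Lemma sub_space_mono (A B : set index) (E : set Omega) : A `<=` B ->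
  measurable (E : set (sub_space Y A)) -> measurable (E : set (sub_space Y B)).
Proof.
move=> AB; apply: smallest_sub; first exact: smallest_sigma_algebra.
move=> _ [s [C [sA mC ->]]]; apply: sub_sigma_algebra.
by exists s, C; split=> // i /sA /AB.
Qed.

Lemma probability_servers (E : 'I_n -> set Omega) :
  (forall j, measurable (E j : set (sub_space Y (server_of j)))) ->
  P [set w | forall j, E j w] = (\prod_j P (E j))%E.
Proof.
move=> mE; pose D (s : seq 'I_n) := [set w | forall j, j \in s -> E j w].
pose A (s : seq 'I_n) : set index :=
  fun z => match z with inl (i, _) | inr (i, _) => i \in s end.
suff H s : uniq s -> measurable (D s : set (sub_space Y (A s))) /\
    P (D s) = (\prod_(j <- s) P (E j))%E.
  have [_ <-] := H (index_enum 'I_n) (index_enum_uniq _).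
  congr (P _); apply/seteqP; split=> w /= h j; first by move=> _; exact: h.
  by apply: h; rewrite mem_index_enum.
elim: s => [_|j s IH /= /andP[js us]].
  have -> : D [::] = setT by apply/seteqP; split.
  by rewrite probability_setT big_nil.
have [mDs PDs] := IH us.
have -> : D (j :: s) = E j `&` D s.
  apply/seteqP; split=> w /= h.
    by split=> [|i si]; apply: h; rewrite inE ?eqxx // si orbT.
  by move=> i; rewrite inE => /orP[/eqP ->|]; [exact: h.1|exact: h.2].
split.
  apply: measurableI.
    by apply: sub_space_mono (mE j) => -[[i m]|[i m]] /= ->; rewrite inE eqxx.
  by apply: sub_space_mono mDs => -[[i m]|[i m]] /= si; rewrite inE si orbT.
rewrite (sub_space_indep indepY _ (mE j) mDs) ?big_cons ?PDs //.
by rewrite -subset0 => -[[i m]|[i m]] [/= ->]; rewrite (negbTE js).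
Qed.

End server_deliveries.

(** * The differential equation of the idle probability *)

Section idle_derivative.
Context {R : realType}.
Implicit Types t h x : R.

Lemma expRN_bounds x : 0 <= x -> 1 - x <= expR (- x) <= 1 - x + x ^+ 2.
Proof.
move=> x0; rewrite expR_ge1Dx /= expRN.
have x1 : 0 < 1 + x by rewrite ltr_wpDr.
apply: (@le_trans _ _ (1 + x)^-1).
  by rewrite lef_pV2 ?posrE ?expR_gt0 // expR_ge1Dx.
rewrite -[X in X <= _]mul1r ler_pdivrMr //.
have : 0 <= x ^+ 3 by rewrite exprn_ge0.
by rewrite (_ : (1 - x + x ^+ 2) * (1 + x) = 1 + x ^+ 3); [lra|ring].
Qed.

(** A two-sided quadratic remainder suffices for differentiability, so no continuity of densities
    has to be discussed. *)
Lemma is_derive_quadratic (f : R -> R) t l C r : 0 < r ->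
  (forall h, `|h| <= r -> `|f (t + h) - f t - h * l| <= C * h ^+ 2) ->
  is_derive t 1 f l.
Proof.
move=> r0 fh.
have C0 : 0 <= C.
  have := le_trans (normr_ge0 _) (fh r _); rewrite (gtr0_norm r0) => /(_ (lexx _)).
  by rewrite pmulr_lge0 // exprn_gt0.
have C1 : 0 < C + 1 by lra.
have fl : h^-1 *: (f (h *: 1 + t) - f t) @[h --> (0 : R)^'] --> l.
  apply/cvgrPdist_le => e e0; near=> h.
  have h0 : h != 0 by near: h; exact: nbhs_dnbhs_neq.
  have hr : `|h| <= r by near: h; exact: dnbhs0_le.
  rewrite /GRing.scale /= mulr1 (addrC h) distrC.
  have -> : h^-1 * (f (t + h) - f t) - l = h^-1 * (f (t + h) - f t - h * l).
    by rewrite [RHS]mulrBr mulrA mulVf // mul1r.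
  rewrite normrM normfV; have h1 : 0 < `|h| by rewrite normr_gt0.
  rewrite mulrC ler_pdivrMr //; apply: (le_trans (fh h hr)).
  rewrite -(real_normK (num_real h)) expr2 mulrA ler_pM2r //.
  have : `|h| <= e / (C + 1).
    by near: h; apply: dnbhs0_le; rewrite divr_gt0 // ltr_wpDl.
  rewrite ler_pdivlMr //; apply: le_trans.
  by rewrite mulrC ler_wpM2l // lerDl.
apply: DeriveDef; last by apply/cvg_lim => //.
by apply/cvg_ex; exists l.
Unshelve. all: by end_near. Qed.

Variables (l m : R) (G : R -> R).
Hypotheses (l0 : 0 < l) (m0 : 0 < m).
Hypothesis GD : forall t h, 0 <= t -> 0 <= h ->
  G (t + h) = expR (- l * h) * G t + (G h - expR (- l * h)) * expR (- m * t).
Hypothesis Gbounds : forall h, 0 <= h ->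
  expR (- m * h) * (1 - expR (- l * h)) <= G h - expR (- l * h)
    <= 1 - expR (- l * h).

Let exp1 r t : 0 < r -> 0 <= t -> 0 <= expR (- r * t) <= 1.
Proof.
move=> r0 t0; rewrite expR_ge0 -expR0 ler_expR mulNr oppr_le0.
by rewrite mulr_ge0 // ltW.
Qed.

Let G01 t : 0 <= t -> 0 <= G t <= 1.
Proof.
move=> t0; have /andP[a1 a2] := Gbounds t0.
have /andP[b1 b2] := exp1 l0 t0; have /andP[c1 c2] := exp1 m0 t0.
apply/andP; split; last by lra.
have := mulr_ge0 c1 (_ : 0 <= 1 - expR (- l * t)); rewrite subr_ge0 => /(_ b2).
by lra.
Qed.

Let lipschitz t h : 0 <= t -> 0 <= h -> `|G (t + h) - G t| <= l * h.
Proof.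
move=> t0 h0; rewrite GD //.
have /andP[a1 a2] := Gbounds h0; have /andP[g0 g1] := G01 t0.
have /andP[b1 b2] := exp1 l0 h0; have /andP[c1 c2] := exp1 m0 h0.
have /andP[d1 d2] := expRN_bounds (mulr_ge0 (ltW l0) h0).
have /andP[e1 e2] := exp1 m0 t0.
rewrite !mulNr in a1 a2 b1 b2 c1 c2 e1 e2 *.
set H := G h - _ in a1 a2 *; set a := expR (- (l * h)) in a1 a2 b1 b2 d1 d2 *.
have H0 : 0 <= H by apply: le_trans a1; rewrite mulr_ge0 // subr_ge0.
set c := expR (- (m * t)) in e1 e2 *.
have p1 : 0 <= H * c <= H by rewrite mulr_ge0 //= ler_piMr.
have p2 : 0 <= (1 - a) * G t <= 1 - a.
  by rewrite mulr_ge0 ?subr_ge0 //= ler_piMr ?subr_ge0.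
rewrite (_ : a * G t + H * c - G t = H * c - (1 - a) * G t); last by ring.
by rewrite ler_norml; lra.
Qed.

Let slope t := m * (expR (- l * t) - G t).

Let C := 2 * l ^+ 2 + l * m + 2 * m ^+ 2.

(** [GD] is used with its arguments exchanged: the short interval h comes first and t last, so that
    only [G h] and [expR (- m * h)] need expanding. Of the constant [C], [m ^+ 2] comes from that
    exponential and the rest from [G h]. *)
Let right_quadratic t h : 0 <= t -> 0 <= h ->
  `|G (t + h) - G t - h * slope t| <= C * h ^+ 2.
Proof.
move=> t0 h0.
have := GD h0 t0; rewrite addrC => ->.
have /andP[a1 a2] := Gbounds h0; have /andP[g0 g1] := G01 t0.
have /andP[b1 b2] := exp1 l0 h0; have /andP[c1 c2] := exp1 m0 h0.
have /andP[d1 d2] := expRN_bounds (mulr_ge0 (ltW l0) h0).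
have /andP[f1 f2] := expRN_bounds (mulr_ge0 (ltW m0) h0).
have /andP[e1 e2] := exp1 l0 t0.
rewrite /slope !mulNr in a1 a2 b1 b2 c1 c2 e1 e2 *.
set a := expR (- (l * h)) in a1 a2 b1 b2 d1 d2 *.
set b := expR (- (m * h)) in a1 c1 c2 f1 f2 *.
set E := expR (- (l * t)) in e1 e2 *.
set K := G h - b.
have -> : E * G h + (G t - E) * b - G t - h * (m * (E - G t)) =
   (b - 1 + m * h) * G t + E * (K - m * h) by rewrite /K; ring.
have K1 : `|K - m * h| <= (2 * l ^+ 2 + l * m + m ^+ 2) * h ^+ 2.
  have q : (1 - b) * (1 - a) <= (m * h) * (l * h).
    by apply: ler_pM; rewrite ?subr_ge0 //; lra.
  by rewrite ler_norml /K; apply/andP; split; nra.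
apply: (le_trans (ler_normD _ _)).
have p1 : `|(b - 1 + m * h) * G t| <= m ^+ 2 * h ^+ 2.
  rewrite normrM (ger0_norm g0) -[leRHS]mulr1; apply: ler_pM => //.
  by rewrite ler_norml; apply/andP; split; nra.
have p2 : `|E * (K - m * h)| <= (2 * l ^+ 2 + l * m + m ^+ 2) * h ^+ 2.
  by rewrite normrM (ger0_norm e1) -[leRHS]mul1r; apply: ler_pM.
by rewrite /C; lra.
Qed.

Lemma is_derive_idle t : 0 < t -> is_derive t 1 G (m * (expR (- l * t) - G t)).
Proof.
(* The radius is t, which keeps the left increments in the domain of the hypotheses. A left
   increment is a right increment from [t - k], and [2 * l * m] pays for moving the slope from
   [t - k] to [t], through the Lipschitz bounds of [G] and of the exponential. *)
move=> t0; apply: (@is_derive_quadratic _ _ _ (C + 2 * l * m) t) => // h.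
have lm : 0 <= l * m by rewrite mulr_ge0 // ltW.
have [h0 _|h0] := leP 0 h.
  apply: le_trans (right_quadratic (ltW t0) h0) _.
  by rewrite ler_wpM2r ?exprn_ge0 // lerDl -mulrA mulr_ge0.
rewrite ltr0_norm // => ht; pose k := - h.
have k0 : 0 <= k by rewrite oppr_ge0 ltW.
have tk : 0 <= t - k by rewrite subr_ge0.
have -> : h = - k by rewrite opprK.
have q := right_quadratic tk k0; rewrite subrK in q.
have lG := lipschitz tk k0; rewrite subrK in lG.
have lE : `|expR (- l * t) - expR (- l * (t - k))| <= l * k.
  have -> : expR (- l * t) = expR (- l * (t - k)) * expR (- l * k).
    by rewrite -expRD; congr expR; ring.
  have /andP[a1 a2] := exp1 l0 tk; have /andP[b1 b2] := exp1 l0 k0.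
  have /andP[d1 d2] := expRN_bounds (mulr_ge0 (ltW l0) k0).
  set E := expR (- l * (t - k)) in a1 a2 *.
  rewrite mulNr in b1 b2 *; set F := expR (- (l * k)) in b1 b2 d1 d2 *.
  have p : 0 <= E * (1 - F) <= 1 - F.
    by rewrite mulr_ge0 ?subr_ge0 //= ler_piMl ?subr_ge0.
  by rewrite ler_norml; lra.
rewrite (_ : G (t - k) - G t - - k * _ = - (G t - G (t - k) - k * slope (t - k)) +
   k * (m * ((expR (- l * t) - expR (- l * (t - k))) - (G t - G (t - k)))));
  last by rewrite /slope; ring.
apply: (le_trans (ler_normD _ _)); rewrite normrN sqrrN mulrDl lerD //.
rewrite !normrM (ger0_norm k0) (ger0_norm (ltW m0)).
have := ler_normB (expR (- l * t) - expR (- l * (t - k))) (G t - G (t - k)).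
move=> /le_trans /(_ (lerD lE lG)) h1.
rewrite [leRHS](_ : _ = k * (m * (l * k + l * k))); last by ring.
by do 2 (rewrite ler_wpM2l //; last exact: ltW m0) || rewrite ler_wpM2l //.
Qed.

End idle_derivative.

(** * Decomposition of the idle probability at the first arrival *)

Section idle_function.
Context {d : measure_display} {Omega : measurableType d} {R : realType}.
Variables (P : probability Omega R) (n : nat) (lam mu : 'I_n -> R).
Variables (X S : 'I_n -> nat -> Omega -> R).
Hypotheses (lam_gt0 : forall j, 0 < lam j) (mu_gt0 : forall j, 0 < mu j).
Hypotheses (expX : forall j k, exp_distributed P (lam j) (X j k)).
Hypotheses (expS : forall j k, exp_distributed P (mu j) (S j k)).
Let Y := all_times X S.
Hypothesis indepY : mutually_independent P Y.
Let index : eqType := (('I_n * nat) + ('I_n * nat))%type.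
Let mX j k : measurable_fun setT (X j k). Proof. exact: (expX j k).1. Qed.
Let mS j k : measurable_fun setT (S j k). Proof. exact: (expS j k).1. Qed.
#[local] Hint Resolve mX mS : core.
Let ge0 := times_ge0_ae expX expS.
Local Notation arr j k := ([set inl (j, k)] : set index).
Local Notation G := (idle P X S).

(** An update arrives by h, and still nothing is delivered t time units after h. By [busyE] the
    probability depends on t only through a factor [surv (mu j) t]. *)
Let busy j h t : set Omega :=
  [set w | X j 0%N w <= h /\ undel (X j ^~ w) (S j ^~ w) 0 (t + h - X j 0%N w)].

Let busyE j (h t : R) : 0 <= h -> 0 <= t ->
  P (busy j h t) = (\int[P]_w ((surv (mu j) t)%:E *
    (surv (mu j) (h - X j 0%N w) * \1_[set w | X j 0%N w <= h] w)%:E))%E.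
Proof.
move=> h0 t0.
pose C (w w' : Omega) := X j 0%N w <= h /\
  undel (X j ^~ w') (S j ^~ w') 0 (t + h - X j 0%N w).
have AB : arr j 0 `&` future j 0 = set0.
  by rewrite -subset0 => z [/= -> [_]]; rewrite ltnn.
have mX1 : @measurable_fun _ _ (sub_space Y (arr j 0) * sub_space Y (future j 0))%type R
    setT (fun z => X j 0%N z.1) by exact: measurable_X1.
rewrite (probability_decouple indepY AB (C := C)); last first.
  apply: measurable_set_and; first exact: measurable_set_le.
  apply: (@measurable_undel _ _ (sub_space Y (arr j 0) * sub_space Y (future j 0))%type
      (fun i z => X j i z.2) (fun i z => S j i z.2)).
  - exact: measurable_funB.
  - by move=> i ki; apply: measurable_X2.
  - by move=> i ki; apply: measurable_S2.
apply: eq_integral => w _; rewrite /C indicE.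
have [Xh|hX] := leP (X j 0%N w) h; last first.
  rewrite memNset /= ?mulr0 ?mule0; last by rewrite leNgt hX.
  by rewrite (_ : [set _ | _] = set0) ?measure0 // -subset0 => w' [].
rewrite mem_set // mulr1.
rewrite (_ : [set _ | _] =
    [set w' | undel (X j ^~ w') (S j ^~ w') 0 (t + h - X j 0%N w)]).
  rewrite (probability_undel lam_gt0 expX expS indepY) -EFinM; congr EFin.
  rewrite !surv_pos ?subr_ge0 ?(le_trans Xh) ?ler_wpDl // -expRD.
  by congr expR; ring.
by apply/seteqP; split=> w' //= -[].
Qed.

Let mbusy j (h t : R) : measurable (busy j h t).
Proof.
apply: measurable_set_and; first exact: measurable_set_le.
by apply: (@measurable_undel _ _ _ (X j) (S j)) => //; exact: measurable_funB.
Qed.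

Let split_idle j (h t : R) : 0 <= h ->
  (G j (t + h))%:E = ((surv (lam j) h * G j t)%:E + P (busy j h t))%E.
Proof.
move=> h0; rewrite -(idleE lam_gt0 expX expS indepY j 0).
rewrite -(probability_idle_init lam_gt0 expX expS indepY j 0 t h0).
rewrite -measureU //.
- congr (P _); apply/seteqP; split=> w /= => [u|[[]//|[]//]].
  by have [Xh|hX] := leP (X j 0%N w) h; [right|left].
- apply: measurable_set_and; first exact: measurable_set_lt.
  by apply: (@measurable_undel _ _ _ (X j) (S j)) => //; exact: measurable_funB.
- by rewrite -subset0 => w [[/= hX _] [/= Xh _]]; rewrite ltNge Xh in hX.
Qed.

Let arrives j (h : R) : G j h - surv (lam j) h = fine (P (busy j h 0)).
Proof.
have E : (G j h)%:E = ((surv (lam j) h)%:E + P (busy j h 0))%E.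
  rewrite -(idleE lam_gt0 expX expS indepY j 0) -(exp_distributed_gt (expX j 0%N)).
  rewrite -measureU //.
  - apply: probability_ae_eq.
    + by apply: (@measurable_undel _ _ _ (X j) (S j)) => //; exact: measurable_funB.
    + by apply: measurableU => //; exact: measurable_set_lt.
    + apply: filterS ge0 => w hw; split=> [u|[hX|[]]] /=.
      * have [Xh|hX] := leP (X j 0%N w) h; [right|by left].
        by rewrite /busy /= add0r.
      * by apply: undel_neg => [i|i|]; [exact: (hw _ _).1|exact: (hw _ _).2|rewrite subr_lt0].
      * by rewrite add0r.
  - exact: measurable_set_lt.
  - by rewrite -subset0 => w [/= hX [/= Xh _]]; rewrite ltNge Xh in hX.
have -> : G j h = surv (lam j) h + fine (P (busy j h 0)).
  by apply: EFin_inj; rewrite E EFinD fineK // fin_num_measure.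
by rewrite addrAC subrr add0r.
Qed.

(** Split according to whether the first update arrives after h. If it does, restart at h from an
    empty server; otherwise the server holds an update at h and survives t more units with the
    exponential factor. *)
Lemma idleD j t h : 0 <= t -> 0 <= h ->
  G j (t + h) = expR (- lam j * h) * G j t +
    (G j h - expR (- lam j * h)) * expR (- mu j * t).
Proof.
move=> t0 h0; rewrite -(surv_pos _ h0) -(surv_pos _ t0) arrives.
apply: EFin_inj; rewrite split_idle // EFinD; congr (_ + _)%E.
rewrite EFinM muleC fineK ?fin_num_measure // !busyE //.
have m1 : measurable_fun setT (fun w =>
    (surv (mu j) (h - X j 0%N w) * \1_[set w | X j 0%N w <= h] w)%:E).
  apply/measurable_EFinP/measurable_funM.
    by apply: measurableT_comp; [exact: measurable_surv|exact: measurable_funB].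
  exact/measurable_indic/measurable_set_le.
rewrite !ge0_integralZl ?lee_fin ?surv_ge0 //; last 2 first.
- by move=> w _; rewrite lee_fin mulr_ge0 // surv_ge0.
- by move=> w _; rewrite lee_fin mulr_ge0 // surv_ge0.
by rewrite (surv_neg _ (lexx 0)) mul1e.
Qed.

Lemma idle_bounds j h : 0 <= h ->
  expR (- mu j * h) * (1 - expR (- lam j * h)) <= G j h - expR (- lam j * h)
    <= 1 - expR (- lam j * h).
Proof.
move=> h0; rewrite -(surv_pos (lam j) h0) -(surv_pos (mu j) h0) arrives.
have PX := exp_distributed_le (expX j 0%N) h.
have mXh : measurable [set w | X j 0%N w <= h] by exact: measurable_set_le.
apply/andP; split; rewrite -lee_fin fineK ?fin_num_measure //; last first.
  by rewrite -PX; apply: le_measure; rewrite ?inE // => w [].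
pose A := [set w | 0 <= X j 0%N w /\ X j 0%N w <= h].
have mA : measurable A.
  by apply: measurable_set_and => //; exact: measurable_set_le.
have PA : P A = (1 - surv (lam j) h)%:E.
  rewrite -PX; apply: probability_ae_eq => //.
  by apply: filterS ge0 => w hw; split=> [[]//|Xh]; split=> //; exact: (hw _ _).1.
rewrite EFinM -PA -integral_indic_probability // -ge0_integralZl ?lee_fin ?surv_ge0 //;
  last exact/measurable_EFinP/measurable_indic.
rewrite busyE //; apply: ge0_le_integral => //.
- by move=> w _; rewrite mule_ge0 ?lee_fin ?surv_ge0.
- exact/measurable_funeM/measurable_EFinP/measurable_indic.
- apply/measurable_funeM/measurable_EFinP/measurable_funM.
    by apply: measurableT_comp; [exact: measurable_surv|exact: measurable_funB].
  exact: measurable_indic.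
- move=> w _; rewrite (surv_neg _ (lexx 0)) mul1e -EFinM lee_fin !indicE.
  have [[X0 Xh]|nA] := pselect (A w); last first.
    by rewrite (memNset nA) mulr0 mulr_ge0 // surv_ge0.
  rewrite !mem_set // !mulr1 !surv_pos ?subr_ge0 // ler_expR !mulNr lerN2.
  by rewrite ler_wpM2l ?gerBl // ltW.
Qed.

Lemma is_derive_idle_gt0 j (t : R) : 0 < t ->
  is_derive t 1 (G j) (mu j * (expR (- lam j * t) - G j t)).
Proof.
by move=> t0; apply: is_derive_idle => // *; [exact: idleD|exact: idle_bounds].
Qed.

End idle_function.

(** * Mean age as an integral *)

Section product_of_survivals.
Context {R : realType}.

Lemma prodr_itv01 (I : Type) (s : seq I) (Q : pred I) (a : I -> R) :
  (forall i, Q i -> 0 <= a i <= 1) -> 0 <= \prod_(i <- s | Q i) a i <= 1.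
Proof.
move=> a01; apply: (big_ind (fun x => 0 <= x <= 1)) => //; first by rewrite ler01 lexx.
by move=> x y /andP[x0 x1] /andP[y0 y1]; rewrite mulr_ge0 // mulr_ile1.
Qed.

Lemma is_derive_prod (I : eqType) (s : seq I) (f : I -> R -> R) (df : I -> R) (x : R) :
  uniq s -> (forall i, i \in s -> is_derive x 1 (f i) (df i)) ->
  is_derive x 1 (fun t => \prod_(i <- s) f i t)
    (\sum_(i <- s) df i * \prod_(k <- s | k != i) f k x).
Proof.
elim: s => [_ _|j s IH /= /andP[js us] fd].
  rewrite big_nil (_ : (fun=> _) = cst 1); last by apply/funext => t; rewrite big_nil.
  exact: is_derive_cst.
have -> : (fun t => \prod_(i <- j :: s) f i t) =
    f j * (fun t => \prod_(i <- s) f i t).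
  by apply/funext => t; rewrite big_cons.
have Hj : is_derive x 1 (f j) (df j) by apply: fd; rewrite inE eqxx.
have Hs := IH us (fun i si => fd i (@mem_behead _ (j :: s) i si)).
apply: is_derive_eq; rewrite big_cons /= !big_cons eqxx /= addrC; congr (_ + _).
  rewrite /GRing.scale /= mulrC; congr (_ * _); rewrite big_seq_cond [RHS]big_seq_cond.
  by apply: eq_bigl => k; case: eqP => [->|]; rewrite ?(negbTE js) ?andbT.
rewrite /GRing.scale /= big_distrr /= big_seq [RHS]big_seq; apply: eq_bigr => i si.
rewrite big_cons (_ : j != i) 1?mulrCA //.
by apply: contraNneq js => ->.
Qed.

Variables (n : nat) (lam mu : 'I_n -> R) (G : 'I_n -> R -> R).
Hypotheses (lam_gt0 : forall j, 0 < lam j) (mu_gt0 : forall j, 0 < mu j).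
Hypothesis dG : forall j (t : R), 0 < t ->
  is_derive t 1 (G j) (mu j * (expR (- lam j * t) - G j t)).
Hypothesis G_le1 : forall j (t : R), 0 <= t -> G j t <= 1.
Hypothesis G_ge : forall j (t : R), 0 <= t -> expR (- lam j * t) <= G j t.
Hypothesis G_ge1Bx : forall j (t : R), 0 <= t -> 1 - lam j * t <= G j t.

Hypothesis G_anti : forall j (t u : R), 0 <= t -> t <= u -> G j u <= G j t.

Let E j (t : R) := expR (- lam j * t).

Definition prod_surv (A : {set 'I_n}) (t : R) : R :=
  \prod_j (if j \in A then E j t else G j t).

Let rate (A : {set 'I_n}) : R := \sum_(j in A) lam j + \sum_(j in ~: A) mu j.

Let G_ge0 j (t : R) : 0 <= t -> 0 <= G j t.
Proof. by move=> t0; apply: le_trans (G_ge j t0); exact: expR_ge0. Qed.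

Lemma prod_surv_ge0 A (t : R) : 0 <= t -> 0 <= prod_surv A t.
Proof.
by move=> t0; apply: prodr_ge0 => j _; case: ifP => _; [exact: expR_ge0|exact: G_ge0].
Qed.

Lemma prod_surv_le A (t : R) : 0 <= t -> prod_surv A t <= prod_surv finset.set0 t.
Proof.
move=> t0; apply: ler_prod => j _; rewrite finset.in_set0.
by case: ifP => _; rewrite ?G_ge0 ?expR_ge0 ?G_ge //=.
Qed.

Lemma one_sub_prod (I : Type) (s : seq I) (a : I -> R) :
  (forall i, 0 <= a i <= 1) -> 1 - \prod_(i <- s) a i <= \sum_(i <- s) (1 - a i).
Proof.
move=> a01; elim: s => [|i s IH]; first by rewrite !big_nil subrr.
have /andP[p0 p1] : 0 <= \prod_(i <- s) a i <= 1 by exact: prodr_itv01.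
by rewrite !big_cons; case/andP: (a01 i) => a0 a1; nra.
Qed.

(** Derivatives are known only for t > 0; this linear bound stands for continuity at 0 with value
    1. *)
Lemma prod_surv_ge A (t : R) : 0 <= t -> 1 - Lam lam * t <= prod_surv A t <= 1.
Proof.
move=> t0.
have E1 j : E j t <= 1 by apply: le_trans (G_ge j t0) (G_le1 j t0).
have a01 j : 0 <= (if j \in A then E j t else G j t) <= 1.
  by case: ifP => _; rewrite ?G_ge0 ?G_le1 ?expR_ge0 ?E1.
apply/andP; split; last by
  case/andP: (@prodr_itv01 _ (index_enum 'I_n) predT _ (fun j _ => a01 j)).
rewrite lerBlDr -lerBlDl; apply: (le_trans (one_sub_prod _ a01)).
rewrite /Lam big_distrl /=; apply: ler_sum => j _.
rewrite lerBlDr -lerBlDl; case: ifP => _; last exact: G_ge1Bx.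
by rewrite /E mulNr expR_ge1Dx.
Qed.

(** Differentiating a factor of A multiplies the product by [- lam j]. Differentiating a factor
    outside A also produces a product with [E j] in place of [G j], that is, the product for
    [j |: A]: hence a triangular system. *)
Lemma is_derive_prod_surv A (t : R) : 0 < t -> is_derive t 1 (prod_surv A)
  (- rate A * prod_surv A t + \sum_(j in ~: A) mu j * prod_surv (j |: A) t).
Proof.
move=> t0.
pose f j t := if j \in A then E j t else G j t.
pose df j := if j \in A then - lam j * E j t else mu j * (E j t - G j t).
have dE j : is_derive t 1 (E j) (- lam j * E j t).
  have dl : is_derive t 1 (fun t => - lam j * t) (- lam j).
    have := @is_deriveZ _ R R id (- lam j) t 1 _ (is_derive_id t 1).
    by rewrite /GRing.scale /= mulr1.
  by have := is_derive1_comp (is_derive_expR (- lam j * t)) dl; rewrite mulrC.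
have H : is_derive t 1 (prod_surv A)
    (\sum_j df j * \prod_(k | k != j) f k t).
  apply: is_derive_prod; first exact: index_enum_uniq.
  by move=> j _; rewrite /f /df; case: ifP => _; [exact: dE|exact: dG].
apply: is_derive_eq.
have Aj j : prod_surv A t = f j t * \prod_(k | k != j) f k t.
  by rewrite /prod_surv (bigD1 j).
have jAj j : prod_surv (j |: A) t = E j t * \prod_(k | k != j) f k t.
  rewrite /prod_surv (bigD1 j) //= setU11; congr (_ * _).
  by apply: eq_bigr => k kj; rewrite !inE (negbTE kj).
rewrite (bigID (mem A)) /= /rate mulNr mulrDl opprD -addrA; congr (_ + _).
  rewrite big_distrl -sumrN /=; apply: eq_bigr => j jA.
  by rewrite (Aj j) /df /f jA; ring.
rewrite big_distrl -sumrN /= -big_split /=; apply: eq_big => j; first by rewrite inE.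
by move=> jA; rewrite (Aj j) jAj /df /f (negbTE jA); ring.
Qed.

Variable V : {set 'I_n} -> R.
Hypothesis VE : forall A : {set 'I_n},
  rate A * V A = 1 + \sum_(j in ~: A) mu j * V (j |: A).
Hypothesis n_gt0 : (0 < n)%N.

Lemma rate_gt0 A : 0 < rate A.
Proof.
have j0 : 'I_n by exact: Ordinal n_gt0.
have := ltW (lam_gt0 _); rewrite /rate.
have L B : 0 <= \sum_(j in B) lam j by apply: sumr_ge0 => j _; exact: ltW.
have M B : 0 <= \sum_(j in B) mu j by apply: sumr_ge0 => j _; exact: ltW.
move=> _; have [jA|jA] := boolP (j0 \in A).
  by rewrite ltr_pwDl // (bigD1 j0) //= ltr_pwDl // sumr_ge0 // => j _; exact: ltW.
rewrite ltr_wpDl // (bigD1 j0) ?inE //= ltr_pwDl // sumr_ge0 // => j _.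
exact: ltW.
Qed.

(* A primitive of [- prod_surv A] vanishing at infinity: since [V A] solves the
   same linear recursion as the integrals over [0, +oo[, it is its value at 0. *)
Lemma tail_primitive A : exists Psi : R -> R,
  [/\ 0 <= V A,
      forall t : R, 0 < t -> is_derive t 1 Psi (- prod_surv A t),
      forall t : R, 0 <= t -> 0 <= V A - Psi t <= Lam lam * t * V A &
      forall t : R, 0 <= t -> 0 <= Psi t <= V A * prod_surv finset.set0 t].
Proof.
have [m] := ubnP #|~: A|; elim: m A => // m IH A cA.
pose Q B (Psi : R -> R) := [/\ 0 <= V B,
   forall t : R, 0 < t -> is_derive t 1 Psi (- prod_surv B t),
   forall t : R, 0 <= t -> 0 <= V B - Psi t <= Lam lam * t * V B &
   forall t : R, 0 <= t -> 0 <= Psi t <= V B * prod_surv finset.set0 t].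
have /choice[Psi PsiE] (j : 'I_n) : exists Psi, j \in ~: A -> Q (j |: A) Psi.
  have [jA|jA] := boolP (j \in ~: A); last by exists (fun=> 0).
  have [|Psi QPsi] := IH (j |: A); last by exists Psi.
  move: cA; rewrite ltnS; apply: leq_trans; apply: proper_card.
  apply/properP; split; first by rewrite finset.setCS finset.subsetU1.
  by exists j => //; rewrite !inE eqxx.
have r0 := rate_gt0 A; have ri0 : 0 <= (rate A)^-1 by rewrite invr_ge0 ltW.
have VA : V A = (rate A)^-1 * (1 + \sum_(j in ~: A) mu j * V (j |: A)).
  by rewrite -VE mulKf // gt_eqF.
(* Formula obtained by integrating [is_derive_prod_surv] from t to infinity, with [Psi j] in place
   of the tail integral for [j |: A]. The induction is on the size of the complement of A. *)
pose Phi t := (rate A)^-1 *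
  (prod_surv A t + \sum_(j in ~: A) mu j * Psi j t).
have sum0 (g : 'I_n -> R) : (forall j, j \in ~: A -> 0 <= g j) ->
    0 <= \sum_(j in ~: A) mu j * g j.
  by move=> g0; apply: sumr_ge0 => j jA; rewrite mulr_ge0 ?g0 // ltW.
exists Phi; split.
- rewrite VA mulr_ge0 // addr_ge0 // sum0 // => j jA.
  by have [] := PsiE j jA.
- move=> t t0.
  have dsum : is_derive t 1 (fun t => \sum_(j in ~: A) mu j * Psi j t)
      (\sum_(j in ~: A) mu j * - prod_surv (j |: A) t).
    have H (j : 'I_n) : is_derive t 1 ((if j \in ~: A then mu j else 0) \*: Psi j : R -> R)
        (if j \in ~: A then mu j * - prod_surv (j |: A) t else 0).
      have [jA|jA] := boolP (j \in ~: A).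
        by apply: is_deriveZ; have [_ + _ _] := PsiE j jA; exact.
      rewrite (_ : _ \*: _ = cst 0); first exact: is_derive_cst.
      by apply/funext => u; rewrite /= /GRing.scale /= mul0r.
    have := is_derive_sum H; rewrite -big_mkcond /=.
    congr is_derive; apply/funext => u; rewrite fct_sumE [RHS]big_mkcond /=.
    by apply: eq_bigr => j _; case: ifP => // _; rewrite /GRing.scale /= mul0r.
  have := is_deriveZ (rate A)^-1 (is_deriveD (is_derive_prod_surv A t0) dsum).
  congr is_derive; rewrite /GRing.scale /=.
  rewrite -addrA -big_split /= big1 => [|j _]; last by ring.
  by rewrite addr0 mulNr mulrN mulKf // gt_eqF.
(* This replaces the initial value V A at 0, where [Phi] is not known to be differentiable. *)
- move=> t t0; have /andP[p0 p1] := prod_surv_ge A t0.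
  rewrite VA /Phi -mulrBr mulrCA.
  have -> : 1 + \sum_(j in ~: A) mu j * V (j |: A) -
      (prod_surv A t + \sum_(j in ~: A) mu j * Psi j t) =
      (1 - prod_surv A t) + \sum_(j in ~: A) mu j * (V (j |: A) - Psi j t).
    by under [in RHS]eq_bigr do rewrite mulrBr; rewrite sumrB; ring.
  rewrite mulr_ge0 //=; last first.
    rewrite addr_ge0 ?subr_ge0 // sum0 // => j jA.
    by have [_ _ + _] := PsiE j jA; move=> /(_ _ t0) /andP[].
  rewrite ler_wpM2l // mulrDr mulr1 lerD //; first by lra.
  rewrite big_distrr /=; apply: ler_sum => j jA.
  rewrite mulrCA ler_wpM2l ?(ltW (mu_gt0 _)) //.
  by have [_ _ + _] := PsiE j jA; move=> /(_ _ t0) /andP[].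
- move=> t t0; rewrite VA /Phi; apply/andP; split.
    rewrite mulr_ge0 // addr_ge0 ?prod_surv_ge0 // sum0 // => j jA.
    by have [_ _ _] := PsiE j jA; move=> /(_ _ t0) /andP[].
  rewrite -mulrA ler_wpM2l // mulrDl mul1r lerD ?prod_surv_le //.
  rewrite big_distrl /=; apply: ler_sum => j jA.
  rewrite -mulrA ler_wpM2l ?(ltW (mu_gt0 _)) //.
  by have [_ _ _] := PsiE j jA; move=> /(_ _ t0) /andP[].
Qed.

Let prod_surv_anti (t u : R) : 0 <= t -> t <= u ->
  prod_surv finset.set0 u <= prod_surv finset.set0 t.
Proof.
move=> t0 tu; apply: ler_prod => j _; rewrite finset.in_set0.
by rewrite G_ge0 ?(le_trans t0) // G_anti.
Qed.

(** Since the product decreases, the mean value theorem puts each increment of the primitive between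
    two consecutive terms of the sum. The three errors are the first cell, the value of the
    primitive at [dl] instead of 0, and its tail. *)
Lemma riemann_prod_surv (dl : R) N : 0 < dl ->
  `|dl * (\sum_(i < N.+1) prod_surv finset.set0 (i.+1%:R * dl)) - V finset.set0|
    <= dl + Lam lam * dl * V finset.set0
       + V finset.set0 * prod_surv finset.set0 (N.+2%:R * dl).
Proof.
move=> dl0; have [Psi [V0 dPsi Psi0 Psioo]] := tail_primitive finset.set0.
set F := prod_surv finset.set0.
have t0 i : 0 < i.+1%:R * dl by rewrite mulr_gt0 // ltr0n.
have t0' i : 0 <= i.+1%:R * dl by exact: ltW.
have step i : dl * F (i.+2%:R * dl) <= Psi (i.+1%:R * dl) - Psi (i.+2%:R * dl)
    <= dl * F (i.+1%:R * dl).
  have lti : i.+1%:R * dl < i.+2%:R * dl by rewrite ltr_pM2r // ltr_nat.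
  have dP x : x \in `]i.+1%:R * dl, i.+2%:R * dl[%R -> is_derive x 1 Psi (- F x).
    by rewrite in_itv /= => /andP[ix _]; apply: dPsi; exact: lt_trans ix.
  have [|c + H] := MVT lti dP.
    apply: derivable_within_continuous => x; rewrite in_itv /= => /andP[ix _].
    by have [] := dPsi x (lt_le_trans (t0 i) ix).
  rewrite in_itv /= => /andP[ic ci].
  have -> : Psi (i.+1%:R * dl) - Psi (i.+2%:R * dl) = dl * F c.
    rewrite -opprB H mulNr opprK mulrC; congr (_ * _).
    by rewrite -mulrBl -natrB // subSnn mul1r.
  have c0 := lt_trans (t0 i) ic.
  by rewrite !ler_pM2l // !prod_surv_anti // ltW.
have lo : Psi dl - Psi (N.+2%:R * dl) <= dl * \sum_(i < N.+1) F (i.+1%:R * dl).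
  elim: N => [|N IH].
    by rewrite big_ord1; have /andP[_] := step 0%N; rewrite !mul1r.
  by rewrite big_ord_recr /= mulrDr; have /andP[_] := step N.+1; lra.
have hi : dl * \sum_(i < N.+1) F (i.+1%:R * dl) <= dl + (Psi dl - Psi (N.+1%:R * dl)).
  elim: N {lo} => [|N IH].
    rewrite big_ord1 mul1r subrr addr0 ler_piMr ?(ltW dl0) //.
    by case/andP: (prod_surv_ge finset.set0 (ltW dl0)).
  by rewrite big_ord_recr /= mulrDr; have /andP[+ _] := step N; lra.
have /andP[a1 a2] := Psi0 _ (ltW dl0).
have /andP[b1 b2] := Psioo _ (t0' N).
have /andP[c1 c2] := Psioo _ (t0' N.+1).
have F0 : 0 <= V finset.set0 * F (N.+2%:R * dl).
  by rewrite mulr_ge0 // prod_surv_ge0.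
by rewrite ler_norml; apply/andP; split; move: lo hi c2; rewrite -/F; lra.
Qed.

End product_of_survivals.

(** * The linear system *)

Section linear_system.
Context {R : realType}.
Variables (n : nat) (hn : (0 < n)%N) (lam mu : 'I_n -> R).

Local Notation q1 q := (q (pos0 hn)).

Definition pos_of (q : 'S_n) (j : 'I_n) : 'I_n := (q^-1)%g j.

Lemma pos_ofK q : cancel (pos_of q) q. Proof. by move=> j; exact: permKV. Qed.
Lemma permK_pos (q : 'S_n) j : pos_of q (q j) = j. Proof. exact: permK. Qed.

(* the server of A that received an update most recently, in state q *)
Definition freshest_in (q : 'S_n) (A : {set 'I_n}) : option 'I_n :=
  [pick j in A | [forall i in A, (pos_of q j <= pos_of q i)%N]].

Lemma freshest_in_Some q (A : {set 'I_n}) j : j \in A ->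
  (forall i, i \in A -> (pos_of q j <= pos_of q i)%N) -> freshest_in q A = Some j.
Proof.
move=> jA jmin; rewrite /freshest_in; case: pickP => [i /andP[iA /forall_inP imin]|].
  congr Some; apply: (can_inj (pos_ofK q)); apply/val_inj/eqP.
  by rewrite eqn_leq imin // jmin.
by move/(_ j); rewrite jA /= => /negP[]; apply/forall_inP.
Qed.

Lemma freshest_in0 q : freshest_in q finset.set0 = None.
Proof. by rewrite /freshest_in; case: pickP => // j; rewrite finset.in_set0. Qed.

Lemma freshest_in1 (q : 'S_n) j : freshest_in q [set j]%SET = Some j.
Proof.
by apply: freshest_in_Some; [rewrite finset.in_set1|move=> i; rewrite finset.in_set1 => /eqP ->].
Qed.

Variant freshest_in_spec q (A : {set 'I_n}) : option 'I_n -> Prop :=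
  | FreshestNone of A = finset.set0 : freshest_in_spec q A None
  | FreshestSome j of j \in A & (forall i, i \in A -> (pos_of q j <= pos_of q i)%N) :
      freshest_in_spec q A (Some j).

Lemma freshest_inP q A : freshest_in_spec q A (freshest_in q A).
Proof.
have [->|[j jA]] := finset.set_0Vmem A; first by rewrite freshest_in0; constructor.
case: (arg_minnP (fun i => val (pos_of q i)) jA) => i iA imin.
by rewrite (freshest_in_Some iA imin); constructor.
Qed.

Definition add_freshest (q : 'S_n) (i : 'I_n) (x : option 'I_n) : option 'I_n :=
  if x is Some j then if (pos_of q i < pos_of q j)%N then Some i else Some j
  else Some i.

Lemma freshest_inU1 (q : 'S_n) i A :
  freshest_in q (i |: A) = add_freshest q i (freshest_in q A).
Proof.
case: (freshest_inP q A) => [->|j jA jmin] /=.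
  by rewrite finset.setU0 freshest_in1.
case: ltnP => ij; apply: freshest_in_Some => [|k].
- by rewrite finset.setU11.
- rewrite finset.in_setU1 => /orP[/eqP -> //|/jmin]; apply: leq_trans; exact: ltnW.
- by rewrite finset.setU1r.
- by rewrite finset.in_setU1 => /orP[/eqP -> //|/jmin].
Qed.

Lemma pos_of_first (q : 'S_n) : pos_of q (q1 q) = 0%N :> nat.
Proof. by rewrite permK_pos. Qed.

Lemma freshest_in_first (q : 'S_n) (A : {set 'I_n}) :
  (freshest_in q A != Some (q1 q)) = (q1 q \notin A).
Proof.
case: (freshest_inP q A) => [->|j jA jmin]; first by rewrite finset.in_set0.
apply/idP/idP => [jq|qA]; last by apply: contraNneq qA => -[<-].
apply: contra jq => /jmin; rewrite pos_of_first leqn0 => /eqP p0.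
apply/eqP; congr Some; apply: (can_inj (pos_ofK q)); apply/val_inj.
by rewrite /= p0 pos_of_first.
Qed.

Lemma hposE (i j : 'I_n) : hpos i j = (if (j < i)%N then j.+1
  else if (i < j)%N then val j else 0%N) :> nat.
Proof.
rewrite /hpos; case: (ltngtP j i) => ji.
- by rewrite val_insubd (leq_ltn_trans ji (ltn_ord i)).
- by rewrite ifF //; apply/negbTE; rewrite neq_ltn ji orbT.
- by rewrite (val_inj ji) eqxx val_insubd hn.
Qed.

Lemma hinv_first (q : 'S_n) i : hinv q i i = q1 q.
Proof.
rewrite /hinv permM permE; congr (q _); apply: val_inj.
by rewrite /= hposE ltnn.
Qed.

(** Only the first server of q changes its rank relative to the others, and it is not in A. *)
Lemma freshest_in_hinv (q : 'S_n) i (A : {set 'I_n}) : q1 q \notin A ->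
  freshest_in (hinv q i) A = freshest_in q A.
Proof.
move=> qA; case: (freshest_inP q A) => [->|j jA jmin]; first exact: freshest_in0.
apply: freshest_in_Some => // k kA.
have posE l : pos_of q l = hpos i (pos_of (hinv q i) l).
  by rewrite -[in LHS](pos_ofK (hinv q i) l) /hinv permM permE permK_pos.
have nz l : l \in A -> (pos_of q l != 0 :> nat)%N.
  move=> lA; apply: contraNneq qA => l0; suff -> : q1 q = l by [].
  by apply: (can_inj (pos_ofK q)); apply/val_inj; rewrite /= l0 pos_of_first.
have := jmin k kA; have := nz _ jA; have := nz _ kA; rewrite !posE !hposE.
move: (pos_of (hinv q i) j) (pos_of (hinv q i) k) => a b.
by case: (ltngtP a i); case: (ltngtP b i) => //= *; lia.
Qed.

Lemma sum_Hinv (q : 'S_n) (g : 'S_n -> R) :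
  \sum_(p in Hinv q) g p = \sum_(i < n) g (hinv q i).
Proof.
rewrite /Hinv big_imset //= => i j _ _ E.
have := hinv_first q i; rewrite E => Ej; rewrite -(hinv_first q j) in Ej.
exact: (perm_inj Ej).
Qed.

Lemma sum_arrivals (v : 'S_n -> option 'I_n -> R) (A : {set 'I_n}) :
  \sum_(q : 'S_n) (q1 q \notin A)%:R * lam (q1 q) *
     (\sum_(p in Hinv q) v p (freshest_in q A)) =
  (\sum_(j in ~: A) lam j) * \sum_(q : 'S_n) v q (freshest_in q A).
Proof.
(* The sum over q and its predecessors is reorganized by predecessor p: moving position i of p to
   the front gives q, so [p i] is the first server of q. For fixed i this is a bijection. *)
pose h i (p : 'S_n) := (p i \notin A)%:R * lam (p i) * v p (freshest_in p A).
transitivity (\sum_(i < n) \sum_(q : 'S_n) h i (hinv q i)).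
  rewrite exchange_big; apply: eq_bigr => q _ /=; rewrite sum_Hinv big_distrr /=.
  apply: eq_bigr => i _; rewrite /h hinv_first.
  by have [|qA] := boolP (q1 q \in A); rewrite ?mul0r // freshest_in_hinv.
transitivity (\sum_(i < n) \sum_(p : 'S_n) h i p).
  apply: eq_bigr => i _; rewrite [RHS](reindex (fun q : 'S_n => hinv q i)) //=.
  exists (fun p : 'S_n => ((hpos_perm i)^-1 * p)%g) => q _; rewrite /hinv.
    by rewrite mulKg.
  by rewrite mulKVg.
rewrite exchange_big /= big_distrr /=; apply: eq_bigr => p _.
rewrite /h -big_distrl /=; congr (_ * _).
rewrite [RHS]big_mkcond [RHS](reindex_inj (@perm_inj _ p)) /=; apply: eq_bigr => i _.
by rewrite finset.in_setC; case: (p i \in A); rewrite /= ?mul0r ?mul1r.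
Qed.

Lemma sum_services (v : 'S_n -> option 'I_n -> R) (A : {set 'I_n}) :
  \sum_(q : 'S_n) \sum_j mu j * v q (add_freshest q j (freshest_in q A)) =
  (\sum_(j in A) mu j) * \sum_(q : 'S_n) v q (freshest_in q A) +
  \sum_(j in ~: A) mu j * \sum_(q : 'S_n) v q (freshest_in q (j |: A)).
Proof.
rewrite exchange_big (bigID (mem A)) /=; congr (_ + _).
  rewrite big_distrl; apply: eq_bigr => j jA /=; rewrite big_distrr.
  apply: eq_bigr => q _; rewrite -freshest_inU1; congr (_ * v q (freshest_in q _)).
  by apply/finset.setUidPr; rewrite finset.sub1set.
apply: eq_big => j; first by rewrite finset.in_setC.
move=> _; rewrite big_distrr; apply: eq_bigr => q _ /=.
by rewrite -freshest_inU1.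
Qed.

(** One expression covers the three kinds of equations. For x the first server of q the arrival term
    is switched off and [add_freshest] never changes x, so the service terms cancel [Lam mu] and
    leave [Lam lam * v q x]. *)
Definition balance (v : 'S_n -> option 'I_n -> R) (q : 'S_n) (x : option 'I_n) : R :=
  (Lam lam + Lam mu) * v q x -
    ((x != Some (q1 q))%:R * lam (q1 q) * (\sum_(p in Hinv q) v p x) +
     \sum_j mu j * v q (add_freshest q j x)).

Lemma sum_services_from (q : 'S_n) (v : option 'I_n -> R) (k : 'I_n) :
  \sum_j mu j * v (add_freshest q j (Some (q k))) =
  \sum_(i < n | (i < k)%N) mu (q i) * v (Some (q i)) +
  (\sum_(i < n | (k <= i)%N) mu (q i)) * v (Some (q k)).
Proof.
rewrite (reindex_inj (@perm_inj _ q)) (bigID (fun i : 'I_n => (i < k)%N)) /=.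
congr (_ + _).
  by apply: eq_bigr => i ik; rewrite /add_freshest !permK_pos ik.
rewrite big_distrl /=; apply: eq_big => i; first by rewrite -leqNgt.
by rewrite /add_freshest !permK_pos => /negbTE ->.
Qed.

Lemma age_systemE v : age_system hn lam mu v <->
  forall q x, balance v q x = piq lam q.
Proof.
have LM (q : 'S_n) : Lam mu = \sum_(i < n | (0 <= i)%N) mu (q i).
  by rewrite /Lam (reindex_inj (@perm_inj _ q)).
have sumq (q : 'S_n) (u : option 'I_n -> R) :
    \sum_j mu j * u (Some j) = \sum_i mu (q i) * u (Some (q i)).
  by rewrite (reindex_inj (@perm_inj _ q)).
split=> [H q x|H q].
  have [H0 H1 H2] := H q; rewrite /balance.
  case: x => [j|]; last first.
    by rewrite H0 mul1r /= (sumq q (v q)); ring.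
  rewrite -(pos_ofK q j); set k := pos_of q j; rewrite (sum_services_from q (v q)).
  rewrite (inj_eq (@Some_inj _)) (inj_eq perm_inj).
  have [->|k0] := eqVneq k (pos0 hn).
    rewrite mul0r mul0r big_pred0 // add0r -H1 (LM q) /=; ring.
  by rewrite mul1r H2 ?lt0n //; ring.
split=> [||k k0].
- have := H q None; rewrite /balance mul1r /= (sumq q (v q)).
  by lra.
- have := H q (Some (q1 q)); rewrite /balance (sum_services_from q (v q)).
  by rewrite eqxx mul0r mul0r big_pred0 // (LM q) /=; lra.
- have := H q (Some (q k)); rewrite /balance (sum_services_from q (v q)).
  rewrite (inj_eq (@Some_inj _)) (inj_eq perm_inj).
  have -> : k != pos0 hn by apply: contraTneq k0 => ->.
  by rewrite mul1r; lra.
Qed.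

End linear_system.

(** * Comparison principle and solvability of the system *)

Section balance_equations.
Context {R : realType}.
Variables (n : nat) (hn : (0 < n)%N) (lam mu : 'I_n -> R).
Hypotheses (lam_gt0 : forall j, 0 < lam j) (mu_gt0 : forall j, 0 < mu j).
Local Notation q1 q := (q (pos0 hn)).
Local Notation bal := (balance hn lam mu).
Implicit Types v : 'S_n -> option 'I_n -> R.

Definition aggregate v (A : {set 'I_n}) : R :=
  \sum_(q : 'S_n) v q (freshest_in q A).

Lemma aggregateE v (A : {set 'I_n}) :
  (\sum_(j in A) lam j + \sum_(j in ~: A) mu j) * aggregate v A =
  \sum_(q : 'S_n) bal v q (freshest_in q A) +
  \sum_(j in ~: A) mu j * aggregate v (j |: A).
Proof.
have split (f : 'I_n -> R) : Lam f = \sum_(j in A) f j + \sum_(j in ~: A) f j.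
  rewrite /Lam (bigID (mem A)) /=; congr (_ + _).
  by apply: eq_bigl => j; rewrite finset.in_setC.
rewrite /balance sumrB big_split /= -big_distrr /= sum_services.
under [X in _ - (X + _)]eq_bigr do rewrite freshest_in_first.
by rewrite sum_arrivals !split /aggregate; ring.
Qed.

(** The off-diagonal coefficients of [balance] have a favourable sign, so the negative part [w] of v
    has nonpositive balance. By induction on the complement of A all its aggregates are then
    nonpositive; being sums of nonnegative terms, they vanish termwise. *)
Lemma balance_ge0 v : (forall q x, 0 <= bal v q x) -> forall q x, 0 <= v q x.
Proof.
move=> bv; pose w q x := Num.max 0 (- v q x).
have w0 q x : 0 <= w q x by rewrite le_max lexx.
have vw q x : - v q x <= w q x by rewrite le_max lexx orbT.
have LM : 0 < Lam lam + Lam mu.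
  have L0 (f : 'I_n -> R) : (forall j, 0 < f j) -> 0 < Lam f.
    move=> f0; rewrite /Lam (bigD1 (pos0 hn)) //= ltr_pwDl // sumr_ge0 // => j _.
    exact: ltW.
  by rewrite addr_gt0 // L0.
have bw q x : bal w q x <= 0.
  have out0 : 0 <= (x != Some (q1 q))%:R * lam (q1 q) *
      (\sum_(p in Hinv q) w p x) + \sum_j mu j * w q (add_freshest q j x).
    rewrite addr_ge0 ?mulr_ge0 ?sumr_ge0 // ?(ltW (lam_gt0 _)) // => j _.
    by rewrite mulr_ge0 // ltW.
  have [v0|v0] := leP 0 (v q x).
    rewrite /balance {1}/w max_l ?oppr_le0 // mulr0 sub0r oppr_le0; exact: out0.
  have := bv q x; rewrite /balance {1}/w max_r ?oppr_ge0 ?(ltW v0) //.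
  have H1 : - (\sum_(p in Hinv q) v p x) <= \sum_(p in Hinv q) w p x.
    by rewrite -sumrN; apply: ler_sum => p _.
  have H2 : - (\sum_j mu j * v q (add_freshest q j x)) <=
      \sum_j mu j * w q (add_freshest q j x).
    rewrite -sumrN; apply: ler_sum => j _; rewrite -mulrN.
    by rewrite ler_wpM2l // ltW.
  have c0 : 0 <= (x != Some (q1 q))%:R * lam (q1 q) by rewrite mulr_ge0 // ltW.
  have := ler_wpM2l c0 H1; rewrite mulrN mulrN.
  move: (Lam lam + Lam mu) => L; lra.
have W0 A : aggregate w A = 0.
  have [m] := ubnP #|~: A|; elim: m A => // m IH A cA.
  have agg0 B : 0 <= aggregate w B by apply: sumr_ge0 => q _.
  have r0 : 0 < \sum_(j in A) lam j + \sum_(j in ~: A) mu j.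
    exact: (rate_gt0 lam_gt0 mu_gt0 hn).
  apply/eqP; rewrite eq_le agg0 andbT -(pmulr_rle0 _ r0) aggregateE.
  rewrite [X in _ + X]big1 ?addr0; last first.
    move=> j jA; rewrite IH ?mulr0 //; move: cA; rewrite ltnS.
    apply: leq_trans; apply: proper_card; apply/properP; split.
      by rewrite finset.setCS finset.subsetU1.
    by exists j => //; rewrite !inE eqxx.
  by apply: sumr_le0 => q _.
(* Singletons and the empty set are enough to reach every unknown as some [freshest_in q A]. *)
move=> q x; pose A : {set 'I_n} := if x is Some j then [set j]%SET else finset.set0.
have fx : freshest_in q A = x.
  by rewrite /A; case: x {A} => [j|]; rewrite ?freshest_in1 ?freshest_in0.
have := W0 A; move=> /eqP; rewrite psumr_eq0 // => /allP /(_ q).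
rewrite mem_index_enum => /(_ isT) /eqP; rewrite fx => wqx.
by have := vw q x; rewrite wqx oppr_le0.
Qed.

Lemma balanceB v w q x : bal (fun q x => v q x - w q x) q x = bal v q x - bal w q x.
Proof.
rewrite /balance.
rewrite sumrB; under [X in _ - (_ + X)]eq_bigr do rewrite mulrBr.
by rewrite sumrB; ring.
Qed.

Lemma balance_inj v w : (forall q x, bal v q x = bal w q x) -> v = w.
Proof.
move=> vw; apply/funext => q; apply/funext => x; apply/eqP; rewrite eq_le.
apply/andP; split; rewrite -subr_ge0.
  apply: (balance_ge0 (v := fun q x => w q x - v q x)) => p y.
  by rewrite balanceB vw subrr.
apply: (balance_ge0 (v := fun q x => v q x - w q x)) => p y.
by rewrite balanceB vw subrr.
Qed.

Lemma balance_surj (b : 'S_n -> option 'I_n -> R) :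
  exists v, forall q x, bal v q x = b q x.
Proof.
pose T := ('S_n * option 'I_n)%type.
pose ext (f : {ffun T -> R^o}) : 'S_n -> option 'I_n -> R := fun q x => f (q, x).
pose L (f : {ffun T -> R^o}) : {ffun T -> R^o} := [ffun z => bal (ext f) z.1 z.2].
have L_linear : linear L.
  move=> a f g; apply/ffunP => -[q x]; rewrite !ffunE /balance /ext /=.
  under [X in _ - (_ * X + _)]eq_bigr do rewrite !ffunE.
  under [X in _ - (_ + X)]eq_bigr do rewrite !ffunE mulrDr.
  rewrite !big_split /= !ffunE /GRing.scale /= -big_distrr /=.
  under [X in _ - (_ + (X + _))]eq_bigr do rewrite mulrCA.
  by rewrite -big_distrr /=; ring.
pose Ll : {linear {ffun T -> R^o} -> {ffun T -> R^o}} :=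
  HB.pack L (GRing.isLinear.Build _ _ _ _ L L_linear).
have Linj : lker (linfun Ll) == 0%VS.
  apply/lker0P => f g; rewrite !lfunE /= => Lfg.
  have : ext f = ext g.
    apply: balance_inj => q x.
    by have := congr1 (fun h : {ffun T -> R^o} => h (q, x)) Lfg; rewrite !ffunE.
  by move=> fg; apply/ffunP => -[q x]; exact: (congr1 (fun h => h q x) fg).
pose c : {ffun T -> R^o} := [ffun z => b z.1 z.2].
have := lker0_lfunVK Linj c; rewrite lfunE /= => Lc.
exists (ext ((linfun Ll)^-1%VF c)) => q x.
by have := congr1 (fun h : {ffun T -> R^o} => h (q, x)) Lc; rewrite !ffunE.
Qed.

End balance_equations.

(** * The weights [piq] as a probability distribution *)

Section stationary_distribution.
Context {R : realType}.

(** Sampling without replacement with weights [lam]. Keeping the last factor, which equals 1, makes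
    the product uniform in n, so that the choice of the first server gives an induction. *)
Let full_piq n (lam : 'I_n -> R) (q : 'S_n) : R :=
  \prod_(k < n) (lam (q k) / \sum_(j : 'I_n | (k <= j)%N) lam (q j)).

Let full_piqE n (lam : 'I_n -> R) (q : 'S_n) : (forall j, 0 < lam j) ->
  piq lam q = full_piq lam q.
Proof.
move=> lam_gt0; rewrite /full_piq (bigID (fun k : 'I_n => (k.+1 < n)%N)) /=.
rewrite [X in _ * X]big1 ?mulr1 // => k; rewrite -leqNgt => nk.
rewrite (big_pred1 k) ?divff ?gt_eqF // => j /=.
apply/idP/eqP => [kj|->//]; apply/val_inj/eqP; rewrite /= eqn_leq kj andbT.
by rewrite -ltnS (leq_trans (ltn_ord j)).
Qed.

Let sum_full_piq n (lam : 'I_n -> R) : (forall j, 0 < lam j) ->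
  \sum_(q : 'S_n) full_piq lam q = 1.
Proof.
elim: n lam => [|n IH] lam lam_gt0.
  rewrite (bigD1 1%g) //= big1 ?addr0 => [|q /eqP[]].
    by rewrite /full_piq big_ord0.
  by apply/permP => -[].
have L0 : 0 < \sum_i lam i.
  by rewrite (bigD1 ord0) //= ltr_pwDl // sumr_ge0 // => j _; exact: ltW.
pose f (z : 'I_n.+1 * 'S_n) : 'S_n.+1 := lift_perm ord0 z.1 z.2.
have f_inj : injective f.
  move=> [i s] [j t] E; have ij : i = j.
    by have := congr1 (fun q : 'S_n.+1 => q ord0) E; rewrite /f !lift_perm_id.
  congr (_, _) => //; apply/permP => k.
  have := congr1 (fun q : 'S_n.+1 => q (lift ord0 k)) E.
  by rewrite /f !lift_perm_lift /= ij => /lift_inj.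
have f_bij : bijective f.
  by apply: inj_card_bij => //; rewrite card_prod card_ord !card_Sn factS.
rewrite (reindex f) /=; last exact: onW_bij.
rewrite -(pair_big predT predT (fun i s => full_piq lam (f (i, s)))) /=.
transitivity (\sum_i (lam i / \sum_i lam i)); last first.
  by rewrite -big_distrl /= divff // gt_eqF.
apply: eq_bigr => i _.
rewrite (eq_bigr (fun s => (lam i / \sum_i lam i) * full_piq (lam \o lift i) s)).
  by rewrite -big_distrr /= IH ?mulr1 // => j; exact: lam_gt0.
move=> s _; rewrite /full_piq big_ord_recl /f /= lift_perm_id.
congr (lam i / _ * _).
  rewrite [RHS](reindex_inj (@perm_inj _ (lift_perm ord0 i s))).
  exact: eq_bigl.
apply: eq_bigr => k _; rewrite lift_perm_lift; congr (_ / _).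
rewrite big_mkcond big_ord_recl /= add0r [RHS]big_mkcond.
by apply: eq_bigr => j _; rewrite lift_perm_lift /= /bump !leq0n.
Qed.

Lemma sum_piq n (lam : 'I_n -> R) : (forall j, 0 < lam j) ->
  \sum_(q : 'S_n) piq lam q = 1.
Proof.
move=> lam_gt0; rewrite -(sum_full_piq lam_gt0).
by apply: eq_bigr => q _; exact: full_piqE.
Qed.

Lemma piq_ge0 n (lam : 'I_n -> R) (q : 'S_n) : (forall j, 0 < lam j) ->
  0 <= piq lam q.
Proof.
move=> lam_gt0; apply: prodr_ge0 => k _; rewrite divr_ge0 ?(ltW (lam_gt0 _)) //.
by apply: sumr_ge0 => j _; exact: ltW.
Qed.

End stationary_distribution.

(** * A strong law for weakly dependent events *)

Section centered_indicators.
Context {d : measure_display} {Omega : measurableType d} {R : realType}.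
Variable P : probability Omega R.

Lemma integral_sqr_centered (I : finType) (E : I -> set Omega) (p : I -> R) :
  (forall i, measurable (E i)) -> (forall i, P (E i) = (p i)%:E) ->
  (\int[P]_w (((\sum_i (\1_(E i) w - p i)) ^+ 2)%R)%:E =
   (\sum_i \sum_j (fine (P (E i `&` E j)) - p i * p j))%:E)%E.
Proof.
move=> mE PE.
have p0 i : 0 <= p i by rewrite -lee_fin -PE.
have m1 i : measurable_fun setT (\1_(E i) : Omega -> R) by exact: measurable_indic.
pose W w : R := \sum_i (\1_(E i) w - p i).
(* The expanded square is written as [B - A] with both parts nonnegative, so that only integrals of
   nonnegative functions appear. *)
pose A w : R := \sum_(z : I * I) (p z.2 * \1_(E z.1) w + p z.1 * \1_(E z.2) w).
pose B w : R := \sum_(z : I * I) (\1_(E z.1 `&` E z.2) w + p z.1 * p z.2).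
have WAB w : W w ^+ 2 + A w = B w.
  rewrite /W expr2 big_distrlr /= pair_big /= /A /B -big_split /=.
  by apply: eq_bigr => -[i j] _ /=; rewrite indicI /=; ring.
have mW : measurable_fun setT W.
  by apply: measurable_sum => i; apply: measurable_funB.
have mA : measurable_fun setT A.
  by apply: measurable_sum => z; apply: measurable_funD; apply: measurable_funM.
have A0 w : 0 <= A w by apply: sumr_ge0 => z _; rewrite addr_ge0 // mulr_ge0.
pose a := \sum_(z : I * I) (p z.1 * p z.2).
have intA : (\int[P]_w (A w)%:E = (a + a)%:E)%E.
  rewrite /A; under eq_integral do rewrite -sumEFin.
  rewrite ge0_integral_sum //; last 2 first.
  - by move=> z; apply/measurable_EFinP/measurable_funD; exact: measurable_funM.
  - by move=> z w _; rewrite lee_fin addr_ge0 // mulr_ge0.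
  rewrite /a -big_split /= -sumEFin; apply: eq_bigr => -[i j] _ /=.
  under eq_integral do rewrite EFinD !EFinM.
  rewrite ge0_integralD //; last 4 first.
  - by move=> w _; rewrite mule_ge0 ?lee_fin.
  - exact/measurable_funeM/measurable_EFinP.
  - by move=> w _; rewrite mule_ge0 ?lee_fin.
  - exact/measurable_funeM/measurable_EFinP.
  rewrite !ge0_integralZl ?lee_fin //; try exact/measurable_EFinP.
  rewrite !integral_indic_probability // !PE -!EFinM -EFinD; congr EFin; ring.
have intB : (\int[P]_w (B w)%:E = (\sum_(z : I * I) fine (P (E z.1 `&` E z.2)) + a)%:E)%E.
  rewrite /B; under eq_integral do rewrite -sumEFin.
  have mEE z : measurable (E z.1 `&` E z.2) by exact: measurableI.
  rewrite ge0_integral_sum //; last 2 first.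
  - by move=> z; apply/measurable_EFinP/measurable_funD.
  - by move=> z w _; rewrite lee_fin addr_ge0 // mulr_ge0.
  rewrite /a -big_split /= -sumEFin; apply: eq_bigr => -[i j] _ /=.
  under eq_integral do rewrite EFinD.
  rewrite ge0_integralD //; last 2 first.
  - exact/measurable_EFinP/measurable_indic/(mEE (i, j)).
  - by move=> w _; rewrite lee_fin mulr_ge0.
  rewrite integral_indic_probability; last exact: (mEE (i, j)).
  have -> : (\int[P]__ (p i * p j)%:E = (p i * p j)%:E)%E.
    by rewrite integral_cst // -[RHS]mule1; congr (_ * _)%E; exact: probability_setT.
  rewrite EFinD fineK //.
  by apply: fin_num_measure; exact: (mEE (i, j)).
have : (\int[P]_w (W w ^+ 2)%:E + (a + a)%:E =
    (\sum_(z : I * I) fine (P (E z.1 `&` E z.2)) + a)%:E)%E.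
  rewrite -intA -intB -ge0_integralD //.
  - by apply: eq_integral => w _; rewrite -EFinD WAB.
  - by move=> w _; rewrite lee_fin sqr_ge0.
  - exact/measurable_EFinP/measurable_funX.
  - by move=> w _; rewrite lee_fin.
  - exact/measurable_EFinP.
rewrite (_ : (\sum_i \sum_j _)%R = \sum_(z : I * I) fine (P (E z.1 `&` E z.2)) - a);
  last by rewrite pair_big /= sumrB.
rewrite -/(W _); case: (\int[P]_w _)%E => [J| |] //=.
by rewrite -EFinD => -[H]; congr EFin; lra.
Qed.

End centered_indicators.

Section decaying_sums.
Context {R : realType}.
Variable s : R.
Hypothesis s01 : 0 <= s < 1.

Let s0 : 0 <= s. Proof. by case/andP: s01. Qed.
Let s1 : 0 < 1 - s. Proof. by rewrite subr_gt0; case/andP: s01. Qed.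

Lemma sum_geometric_le N : \sum_(i < N) s ^+ i <= (1 - s)^-1.
Proof.
rewrite -[leRHS]mul1r ler_pdivlMr // mulrC.
have : (1 - s) * \sum_(i < N) s ^+ i = 1 - s ^+ N.
  elim: N => [|N IH]; first by rewrite big_ord0 mulr0 expr0 subrr.
  by rewrite big_ord_recr /= mulrDr IH exprS; ring.
by move=> ->; rewrite gerBl exprn_ge0.
Qed.

(** With truncated subtraction the exponent is the distance of k and l. Adding an index brings a
    row, a column and a diagonal term, each at most [(1 - s)^-1]. *)
Lemma sum_dist_le N : \sum_(k < N) \sum_(l < N) s ^+ ((k - l) + (l - k)) <=
  N%:R * (3 / (1 - s)).
Proof.
elim: N => [|N IH]; first by rewrite big_ord0 mul0r.
rewrite big_ord_recr /=; under eq_bigr do rewrite big_ord_recr /=.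
rewrite big_split /= big_ord_recr /= subnn expr0.
have H : \sum_(l < N) s ^+ ((N - l) + (l - N)) <= (1 - s)^-1.
  apply: le_trans (sum_geometric_le N); rewrite (reindex_inj rev_ord_inj) /=.
  apply: ler_sum => l _; apply: ler_wiXn2l => //; first by case/andP: s01 => _ /ltW.
  by have := ltn_ord l; lia.
have H' : \sum_(k < N) s ^+ ((k - N) + (N - k)) <= (1 - s)^-1.
  by under eq_bigr do rewrite addnC.
have H1 : 1 <= (1 - s)^-1.
  by rewrite invf_ge1 // gerBl.
by rewrite -natr1 mulrDl mul1r; lra.
Qed.

End decaying_sums.

Section strong_law.
Context {d : measure_display} {Omega : measurableType d} {R : realType}.
Variable P : probability Omega R.
Variables (D : nat -> nat -> set Omega) (g : nat -> R) (s : R).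
Hypothesis s01 : 0 <= s < 1.
Hypothesis mD : forall k i, measurable (D k i).
Hypothesis PD : forall k i, (i < k)%N -> P (D k i) = (g i)%:E.
Hypothesis indepD : forall k l i j, (i < k)%N -> (j < l)%N -> (k + j < l)%N ->
  P (D k i `&` D l j) = (g i * g j)%:E.
Hypothesis g_decay : forall i, g i <= s ^+ (4 * i).

Definition count_upto N (w : Omega) : R := \sum_(k < N) \sum_(i < k) \1_(D k i) w.
Let mean_upto N : R := \sum_(k < N) \sum_(i < k) g i.

Let s0 : 0 <= s. Proof. by case/andP: s01. Qed.
Let s1 : 0 < 1 - s. Proof. by rewrite subr_gt0; case/andP: s01. Qed.
Let sX i j : (i <= j)%N -> s ^+ j <= s ^+ i.
Proof. by move=> ij; apply: ler_wiXn2l => //; case/andP: s01 => _ /ltW. Qed.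

Let g0 i : 0 <= g i.
Proof. by rewrite -lee_fin -(PD (ltnSn i)). Qed.

(** For k <= l, either the windows are disjoint and the covariance is 0, or l - k <= j. In the
    second case l - k, i and j are all at most [maxn i j], so the decay of the rarer event pays for
    the three factors. *)
Let covariance_le k l i j : (i < k)%N -> (j < l)%N ->
  fine (P (D k i `&` D l j)) - g i * g j <=
  s ^+ ((k - l) + (l - k)) * (s ^+ i * s ^+ j).
Proof.
wlog kl : k l i j / (k <= l)%N => [wl ik jl|ik jl].
  have [kl|/ltnW lk] := leqP k l; first exact: wl.
  by rewrite setIC mulrC addnC [s ^+ i * _]mulrC; exact: wl.
rewrite (eqP kl) add0n; have [klj|jkl] := ltnP (k + j)%N l.
  by rewrite indepD // subrr !mulr_ge0 // exprn_ge0.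
have PDD : fine (P (D k i `&` D l j)) <= s ^+ (4 * maxn i j).
  rewrite -lee_fin fineK; last by apply: fin_num_measure; exact: measurableI.
  have mI : measurable (D k i `&` D l j) by exact: measurableI.
  have [ij|ji] := leqP i j.
    apply: (@le_trans _ _ (P (D l j))); last by rewrite PD // lee_fin.
    by apply: le_measure; rewrite ?inE // => w [].
  apply: (@le_trans _ _ (P (D k i))); last by rewrite PD // lee_fin.
  by apply: le_measure; rewrite ?inE // => w [].
apply: (@le_trans _ _ (s ^+ (4 * maxn i j))).
  by apply: le_trans PDD; rewrite gerBl mulr_ge0.
by rewrite -!exprD; apply: sX; lia.
Qed.

Lemma variance_count_upto N :
  (\int[P]_w (((count_upto N w - mean_upto N) ^+ 2)%R)%:E <=
   (N%:R * (3 / (1 - s) ^+ 3))%:E)%E.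
Proof.
pose I := ('I_N * 'I_N)%type.
pose E (z : I) : set Omega := if (z.2 < z.1)%N then D z.1 z.2 else set0.
pose p (z : I) : R := if (z.2 < z.1)%N then g z.2 else 0.
have mE z : measurable (E z) by rewrite /E; case: ifP.
have PE z : P (E z) = (p z)%:E.
  by rewrite /E /p; case: ifPn => [zz|_]; [exact: PD|rewrite measure0].
have widen (k : 'I_N) (f : nat -> R) :
    \sum_(i < k) f i = \sum_(i < N) (if (i < k)%N then f i else 0).
  by rewrite (big_ord_widen _ _ (ltnW (ltn_ord k))) big_mkcond.
have WE w : count_upto N w - mean_upto N = \sum_z (\1_(E z) w - p z).
  rewrite /count_upto /mean_upto -sumrB.
  transitivity (\sum_(k < N) \sum_(i < N) (\1_(E (k, i)) w - p (k, i))); last first.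
    by rewrite pair_big /=; apply: eq_bigr => -[].
  apply: eq_bigr => k _; rewrite (widen k (fun i => \1_(D k i) w)) (widen k g) -sumrB.
  apply: eq_bigr => i _; rewrite /E /p /=.
  by case: ifP => // _; rewrite indic0.
under eq_integral do rewrite WE.
rewrite (integral_sqr_centered mE PE) lee_fin.
pose h (z z' : I) := s ^+ ((z.1 - z'.1) + (z'.1 - z.1)) * (s ^+ z.2 * s ^+ z'.2).
apply: (@le_trans _ _ (\sum_z \sum_z' h z z')).
  apply: ler_sum => -[k i] _; apply: ler_sum => -[l j] _.
  rewrite /h /E /p /=; have [ik|_] := ifPn; last first.
    by rewrite set0I measure0 mul0r subrr !mulr_ge0 // exprn_ge0.
  have [jl|_] := ifPn; last first.
    by rewrite setI0 measure0 mulr0 subrr !mulr_ge0 // exprn_ge0.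
  exact: covariance_le.
have -> : \sum_z \sum_z' h z z' =
    (\sum_(k < N) \sum_(l < N) s ^+ ((k - l) + (l - k))) *
    ((\sum_(i < N) s ^+ i) * (\sum_(i < N) s ^+ i)).
  rewrite -(pair_big predT predT (fun k i => \sum_z' h (k, i) z')) /= big_distrl /=.
  apply: eq_bigr => k _; rewrite big_distrl /=.
  transitivity (\sum_(i < N) \sum_(l < N) \sum_(j < N) h (k, i) (l, j)).
    by apply: eq_bigr => i _; rewrite pair_big /=; apply: eq_bigr => -[].
  rewrite exchange_big /=; apply: eq_bigr => l _.
  rewrite /h /= big_distrlr /= big_distrr /=; apply: eq_bigr => i _.
  by rewrite big_distrr.
have G0 : 0 <= \sum_(i < N) s ^+ i by apply: sumr_ge0 => i _; rewrite exprn_ge0.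
have G1 := sum_geometric_le s01 N.
rewrite (_ : N%:R * _ = N%:R * (3 / (1 - s)) * ((1 - s)^-1 * (1 - s)^-1)); last first.
  by rewrite -mulrA; congr (_ * _); field; rewrite gt_eqF.
apply: ler_pM; rewrite ?mulr_ge0 //; last by apply: ler_pM.
  by apply: sumr_ge0 => k _; apply: sumr_ge0 => l _; rewrite exprn_ge0.
exact: sum_dist_le.
Qed.

Let C := 3 / (1 - s) ^+ 3.

Let C0 : 0 <= C. Proof. by rewrite divr_ge0 // exprn_ge0 // ltW. Qed.

Let sum_inv_sqr N : \sum_(m < N) (m.+1%:R ^- 2) <= 2 :> R.
Proof.
have H : \sum_(m < N.+1) (m.+1%:R ^- 2) <= 2 - N.+1%:R^-1 :> R.
  elim: N => [|N IH]; first by rewrite big_ord1 expr1n invr1; lra.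
  rewrite big_ord_recr /=; apply: le_trans (lerD IH (lexx _)) _.
  have N0 : 0 < N.+1%:R :> R by rewrite ltr0n.
  have -> : N.+2%:R = N.+1%:R + 1 :> R by rewrite -natr1.
  move: (N.+1%:R : R) N0 => x x0; have x1 : 0 < x + 1 by rewrite ltr_wpDr.
  rewrite -subr_ge0 (_ : _ - _ = (x * (x + 1) ^+ 2)^-1).
    by rewrite invr_ge0 mulr_ge0 ?exprn_ge0 // ltW.
  by field; rewrite !gt_eqF.
have : \sum_(m < N) (m.+1%:R ^- 2) <= \sum_(m < N.+1) (m.+1%:R ^- 2) :> R.
  by rewrite big_ord_recr /= lerDl invr_ge0 exprn_ge0.
by move/le_trans; apply; apply: le_trans H _; rewrite gerBl.
Qed.

Let dev m (w : Omega) : R :=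
  (count_upto (m.+1 ^ 2) w - mean_upto (m.+1 ^ 2)) / (m.+1 ^ 2)%N%:R.

(** A variance linear in N makes the squared deviations along squares summable in mean. Their sum is
    then almost surely finite, so its terms tend to 0. *)
Lemma deviation_cvg0 : {ae P, forall w, dev m w @[m --> \oo] --> (0 : R)}.
Proof.
have mcount N : measurable_fun setT (count_upto N).
  apply: measurable_sum => k; apply: measurable_sum => i.
  exact: measurable_indic.
have mdev m : measurable_fun setT (fun w => (dev m w ^+ 2)%:E).
  apply/measurable_EFinP/measurable_funX/measurable_funM => //.
  exact: measurable_funB.
have dev0 m w : (0 <= (dev m w ^+ 2)%:E)%E by rewrite lee_fin sqr_ge0.
have Idev m : (\int[P]_w (dev m w ^+ 2)%:E <= (C * m.+1%:R ^- 2)%:E)%E.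
  pose c : R := (m.+1 ^ 2)%N%:R; have c0 : 0 < c by rewrite ltr0n expn_gt0.
  have E w : (dev m w ^+ 2)%:E = ((c ^- 2)%:E *
      ((count_upto (m.+1 ^ 2) w - mean_upto (m.+1 ^ 2)) ^+ 2)%:E)%E.
    by rewrite -EFinM /dev -/c exprMn exprVn mulrC.
  under eq_integral do rewrite E.
  rewrite ge0_integralZl ?lee_fin ?invr_ge0 ?exprn_ge0 ?(ltW c0) //; last 2 first.
  - by apply/measurable_EFinP/measurable_funX/measurable_funB.
  - by move=> w _; rewrite lee_fin sqr_ge0.
  apply: (le_trans (lee_wpmul2l _ (variance_count_upto _))).
    by rewrite lee_fin invr_ge0 exprn_ge0 // ltW.
  have cC : c ^- 2 * (c * C) = C * c^-1 by rewrite expr2; field; rewrite gt_eqF.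
  by rewrite -EFinM lee_fin -/c -/C cC /c natrX.
have fin_sum : (\int[P]_w (\sum_(m <oo) (dev m w ^+ 2)%:E) <= (C * 2)%:E)%E.
  rewrite integral_nneseries //; apply: lime_le.
    by apply: is_cvg_nneseries => m *; apply: integral_ge0 => w _; exact: dev0.
  apply: nearW => N; rewrite big_mkord.
  apply: (@le_trans _ _ (\sum_(m < N) (C * m.+1%:R ^- 2)%:E)%E).
    by apply: lee_sum => m _; exact: Idev.
  by rewrite sumEFin lee_fin -big_distrr /=; apply: ler_wpM2l => //; exact: sum_inv_sqr.
have : P.-integrable setT (fun w => \sum_(m <oo) (dev m w ^+ 2)%:E)%E.
  apply/integrableP; split.
    by apply: ge0_emeasurable_sum.
  under eq_integral do rewrite gee0_abs ?nneseries_ge0 //.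
  exact: le_lt_trans fin_sum (ltry _).
move=> /(integrable_ae measurableT); apply: filterS => w /(_ I) sfin.
have sq : dev m w ^+ 2 @[m --> \oo] --> (0 : R).
  apply: cvg_series_cvg_0; apply: nondecreasing_is_cvgn.
    by apply/nondecreasing_seqP => m; rewrite /series /= big_nat_recr //= lerDl sqr_ge0.
  exists (fine (\sum_(m <oo) (dev m w ^+ 2)%:E)%E) => _ [N _ <-].
  rewrite -lee_fin fineK // /series /= -sumEFin.
  exact: (@nneseries_lim_ge _ (fun m => (dev m w ^+ 2)%:E) xpredT 0 N).
have : Num.sqrt (dev m w ^+ 2) @[m --> \oo] --> (0 : R).
  rewrite -(@sqrtr0 R); apply: continuous_cvg => //; exact: sqrt_continuous.
under eq_cvg do rewrite sqrtr_sqr.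
by move/norm_cvg0P.
Qed.

Lemma strong_law (gamma : R) : series g @ \oo --> gamma ->
  {ae P, forall w, count_upto N.+1 w / N.+1%:R @[N --> \oo] --> gamma}.
Proof.
move=> gG; have mean_cvg : mean_upto N.+1 / N.+1%:R @[N --> \oo] --> gamma.
  have := cesaro gG; apply: cvg_trans; apply: near_eq_cvg; apply: nearW => N /=.
  rewrite /arithmetic_mean /= /series /= /mean_upto big_mkord mulrC; congr (_ * _).
  by apply: eq_bigr => k _; rewrite big_mkord.
apply: filterS deviation_cvg0 => w dev_cvg.
pose a m := count_upto (m.+1 ^ 2) w / (m.+1 ^ 2)%N%:R.
have a_cvg : a m @[m --> \oo] --> gamma.
  have sqr_oo : ((m.+1 ^ 2).-1)%N @[m --> \oo] --> \oo.
    move=> A [M _ MA]; exists M => // m /= Mm; apply: MA.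
    have mm : (m < m.+1 ^ 2)%N by rewrite -mulnn; nia.
    suff : (M <= (m.+1 ^ 2).-1)%N by [].
    by apply: (leq_trans Mm); move: (m.+1 ^ 2)%N mm => x; lia.
  rewrite -[gamma]add0r (_ : a = (fun m => dev m w) \+
      ((fun N => mean_upto N.+1 / N.+1%:R) \o (fun m => (m.+1 ^ 2).-1)%N)).
    by apply: cvgD => //; exact: (cvg_comp _ _ sqr_oo mean_cvg).
  apply/funext => m; transitivity (dev m w + mean_upto (m.+1 ^ 2).-1.+1 /
    (m.+1 ^ 2).-1.+1%:R); last by [].
  by rewrite prednK ?expn_gt0 // /dev -mulrDl subrK.
(* Between consecutive squares the count is monotone, and the ratio of these squares is
   [rho m ^+ 2], which tends to 1. *)
have /choice[rt rtE] : forall N, exists m, (m.+1 ^ 2 <= N.+1 < m.+2 ^ 2)%N.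
  elim=> [|N [m /andP[m1 m2]]]; first by exists 0%N.
  have [Nm|mN] := ltnP N.+2 (m.+2 ^ 2)%N; first by exists m; rewrite Nm (leqW m1).
  by exists m.+1; rewrite mN /=; move: m2; rewrite -!mulnn; nia.
have rt_oo : rt N @[N --> \oo] --> \oo.
  move=> A [M _ MA]; exists (M.+1 ^ 2)%N => // N /= MN; apply: MA => /=.
  by have /andP[_] := rtE N; rewrite leqNgt; move: MN; rewrite -!mulnn; nia.
have count_mono M N : (M <= N)%N -> count_upto M w <= count_upto N w.
  move=> MN; rewrite /count_upto -(subnKC MN) big_split_ord /= lerDl.
  by apply: sumr_ge0 => k _; apply: sumr_ge0.
have count0 N : 0 <= count_upto N w by apply: sumr_ge0 => k _; apply: sumr_ge0.
pose rho m : R := 1 + harmonic m.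
have rho_cvg : rho m @[m --> \oo] --> (1 : R).
  by rewrite -[X in _ --> X]addr0; apply: cvgD; [exact: cvg_cst|exact: cvg_harmonic].
have rhoE m : rho m = m.+2%:R / m.+1%:R.
  by rewrite /rho /harmonic /= -[m.+2%:R]natr1 mulrDl mul1r divff.
have rho2_cvg : rho m ^+ 2 @[m --> \oo] --> (1 : R).
  by rewrite -[X in _ --> X](mulr1 1); apply: cvgM.
apply: (@squeeze_cvgr _ _ _ _ (fun N => a (rt N) / rho (rt N) ^+ 2)
  (fun N => a (rt N).+1 * rho (rt N) ^+ 2)).
- apply: nearW => N; have /andP[r1 r2] := rtE N; set m := rt N in r1 r2 *.
  have pos k : 0 < k.+1%:R :> R by rewrite ltr0n.
  have -> : a m / rho m ^+ 2 = count_upto (m.+1 ^ 2) w / (m.+2 ^ 2)%N%:R.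
    by rewrite /a rhoE !natrX; field; rewrite !gt_eqF.
  have -> : a m.+1 * rho m ^+ 2 = count_upto (m.+2 ^ 2) w / (m.+1 ^ 2)%N%:R.
    by rewrite /a rhoE !natrX; field; rewrite !gt_eqF.
  apply/andP; split; apply: ler_pM; rewrite ?invr_ge0 ?ler0n ?count_mono //.
  + by rewrite lef_pV2 ?posrE ?ltr0n ?expn_gt0 // ler_nat ltnW.
  + exact: ltnW.
  + by rewrite lef_pV2 ?posrE ?ltr0n ?expn_gt0 // ler_nat.
- rewrite -[X in _ --> X]divr1; apply: cvgM; first exact: (cvg_comp _ _ rt_oo a_cvg).
  apply: cvgV => //; exact: (cvg_comp _ _ rt_oo rho2_cvg).
- rewrite -[X in _ --> X]mulr1; apply: cvgM; last exact: (cvg_comp _ _ rt_oo rho2_cvg).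
  have aS : a m.+1 @[m --> \oo] --> gamma by rewrite (cvg_shiftS a).
  exact: (cvg_comp _ _ rt_oo aS).
Qed.

End strong_law.

(** * Discretization of the age process *)

Section grid_events.
Context {d : measure_display} {Omega : measurableType d} {R : realType}.
Variables (P : probability Omega R) (n : nat) (lam mu : 'I_n -> R).
Variables (X S : 'I_n -> nat -> Omega -> R).
Hypothesis n_gt0 : (0 < n)%N.
Hypotheses (lam_gt0 : forall j, 0 < lam j) (mu_gt0 : forall j, 0 < mu j).
Hypotheses (expX : forall j k, exp_distributed P (lam j) (X j k)).
Hypotheses (expS : forall j k, exp_distributed P (mu j) (S j k)).
Let Y := all_times X S.
Hypothesis indepY : mutually_independent P Y.
Local Notation G := (idle P X S).
Local Notation F := (prod_surv lam G finset.set0).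

Lemma idle_ge_exp j (t : R) : 0 <= t -> expR (- lam j * t) <= G j t.
Proof.
move=> t0; have /andP[+ _] := idle_bounds lam_gt0 mu_gt0 expX expS indepY j t0.
rewrite -[leRHS]subr0 -subr_ge0 => H.
have e1 : expR (- lam j * t) <= 1.
  by rewrite -expR0 ler_expR mulNr oppr_le0 mulr_ge0 // ltW.
have : 0 <= expR (- mu j * t) * (1 - expR (- lam j * t)).
  by rewrite mulr_ge0 ?expR_ge0 // subr_ge0.
lra.
Qed.

Lemma idle_le1 j (t : R) : 0 <= t -> G j t <= 1.
Proof.
by move=> t0; have /andP[_] := idle_bounds lam_gt0 mu_gt0 expX expS indepY j t0; lra.
Qed.

(** Strictness makes the tails geometric. Halving t lets an update arrive in the first half and be
    delivered in the second. *)
Lemma idle_lt1 j (t : R) : 0 < t -> G j t < 1.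
Proof.
move=> t0; have h0 : 0 < t / 2 by rewrite divr_gt0.
have -> : t = t / 2 + t / 2 by rewrite -splitr.
rewrite (idleD lam_gt0 expX expS indepY) ?(ltW h0) //.
have /andP[_ H] := idle_bounds lam_gt0 mu_gt0 expX expS indepY j (ltW h0).
have G1 := idle_le1 j (ltW h0).
have e r : 0 < r -> 0 < expR (- r * (t / 2)) < 1.
  by move=> r0; rewrite expR_gt0 /= expR_lt1 mulNr oppr_lt0; exact: mulr_gt0.
have /andP[l0 l1] := e _ (lam_gt0 j); have /andP[m0 m1] := e _ (mu_gt0 j).
set a := expR (- lam j * _) in H l0 l1 *; set b := expR (- mu j * _) in m0 m1 *.
have p1 : a * G j (t / 2) <= a by rewrite ler_piMr // ltW.
have p2 : (G j (t / 2) - a) * b <= (1 - a) * b by rewrite ler_wpM2r // ltW.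
have p3 : (1 - a) * b < 1 - a by rewrite -[ltRHS]mulr1 ltr_pM2l // subr_gt0.
lra.
Qed.

Lemma idle_anti j (t u : R) : t <= u -> G j u <= G j t.
Proof.
move=> tu; rewrite -lee_fin -!(idleE lam_gt0 expX expS indepY j 0).
have mu' (b : R) : measurable [set w | undel (X j ^~ w) (S j ^~ w) 0 (b - X j 0%N w)].
  apply: (@measurable_undel _ _ _ (X j) (S j)) => [|i _|i _].
  - by apply: measurable_funB; [exact: measurable_cst|exact: (expX j 0%N).1].
  - exact: (expX j i).1.
  - exact: (expS j i).1.
apply: le_measure; rewrite ?inE // => w h m /h; apply: le_lt_trans.
by rewrite lerD2r.
Qed.

Lemma prod_idleE t : F t = \prod_j G j t.
Proof. by apply: eq_bigr => j _; rewrite finset.in_set0. Qed.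

Lemma prod_idle_ge0 t : 0 <= F t.
Proof. by rewrite prod_idleE; apply: prodr_ge0 => j _; exact: idle_ge0. Qed.

Lemma prod_idle_submul (a b : R) : 0 <= a -> 0 <= b -> F (a + b) <= F a * F b.
Proof.
move=> a0 b0; rewrite !prod_idleE -big_split /=; apply: ler_prod => j _.
by rewrite idle_ge0 (idle_submul lam_gt0 expX expS indepY).
Qed.

Lemma prod_idle_lt1 (t : R) : 0 < t -> F t < 1.
Proof.
move=> t0; rewrite prod_idleE (bigD1 (Ordinal n_gt0)) //=.
apply: (@le_lt_trans _ _ (G (Ordinal n_gt0) t)); last exact: idle_lt1.
rewrite ler_piMr ?idle_ge0 //.
have G01 j : j != Ordinal n_gt0 -> 0 <= G j t <= 1.
  by move=> _; rewrite idle_ge0 idle_le1 // ltW.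
by case/andP: (prodr_itv01 (index_enum 'I_n) G01).
Qed.

Lemma prod_idle_geometric (dl : R) i : 0 < dl -> F (i.+1%:R * dl) <= F dl ^+ i.+1.
Proof.
move=> dl0; elim: i => [|i IH]; first by rewrite mul1r expr1.
have -> : i.+2%:R * dl = dl + i.+1%:R * dl.
  by rewrite -[i.+2%:R]natr1 mulrDl mul1r addrC.
apply: (le_trans (prod_idle_submul (ltW dl0) _)); first by rewrite mulr_ge0 // ltW.
by rewrite exprS ler_wpM2l // prod_idle_ge0.
Qed.

(* the age at time [k%:R * dl] is at least [i.+1%:R * dl] *)
Definition old (dl : R) (k i : nat) : set Omega :=
  [set w | forall j, stale X S j (k%:R * dl) ((k - i.+1)%N%:R * dl) w].

Lemma measurable_old dl k i : measurable (old dl k i).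
Proof.
rewrite (_ : old dl k i = \bigcap_(j in @setT 'I_n)
   stale X S j (k%:R * dl) ((k - i.+1)%N%:R * dl)).
  apply: fin_bigcap_measurable => // j _.
  exact: (measurable_stale indepY).
by apply/seteqP; split=> w h j //; exact: h.
Qed.

Lemma probability_old dl k i : 0 < dl -> (i < k)%N ->
  P (old dl k i) = (F (i.+1%:R * dl))%:E.
Proof.
move=> dl0 ik; rewrite (probability_servers indepY
    (E := fun j => stale X S j (k%:R * dl) ((k - i.+1)%N%:R * dl))); last first.
  by move=> j; exact: measurable_stale_in.
rewrite prod_idleE -prodEFin; apply: eq_bigr => j _.
rewrite (probability_stale lam_gt0 expX expS indepY) ?mulr_ge0 ?(ltW dl0) //.
by rewrite natrB // mulrBl opprB addrC subrK.
Qed.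

(** The condition [k + j < l] says that the window of the second event starts at or after time
    [k%:R * dl], as [probability_stale2] requires at each server. *)
Lemma probability_oldI dl k l i j : 0 < dl -> (i < k)%N -> (j < l)%N -> (k + j < l)%N ->
  P (old dl k i `&` old dl l j) = (F (i.+1%:R * dl) * F (j.+1%:R * dl))%:E.
Proof.
move=> dl0 ik jl kjl.
pose s1 a := stale X S a (k%:R * dl) ((k - i.+1)%N%:R * dl).
pose s2 a := stale X S a (l%:R * dl) ((l - j.+1)%N%:R * dl).
have -> : old dl k i `&` old dl l j = [set w | forall a, (s1 a `&` s2 a) w].
  apply/seteqP; split=> w; first by move=> [h1 h2] a; split; [exact: h1|exact: h2].
  by move=> h; split=> a; have [] := h a.
rewrite (probability_servers indepY (E := fun a => s1 a `&` s2 a)); last first.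
  by move=> a; apply: measurableI; exact: measurable_stale_in.
rewrite !prod_idleE -big_split /= -prodEFin; apply: eq_bigr => a _.
rewrite (probability_stale2 lam_gt0 expX expS indepY).
- rewrite (probability_stale lam_gt0 expX expS indepY) ?mulr_ge0 ?(ltW dl0) // -EFinM.
  by rewrite !natrB // !mulrBl !opprB ![_ * dl + (_ - _)]addrC !subrK.
- by rewrite mulr_ge0 // ltW.
- by rewrite ler_pM2r // ler_nat; lia.
Qed.

Variable V : {set 'I_n} -> R.
Hypothesis VE : forall A : {set 'I_n},
  (\sum_(j in A) lam j + \sum_(j in ~: A) mu j) * V A =
  1 + \sum_(j in ~: A) mu j * V (j |: A).

Lemma mean_old_cvg (dl : R) : 0 < dl -> exists gamma : R,
  series (fun i => F (i.+1%:R * dl)) @ \oo --> gamma /\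
  `|dl * gamma - V finset.set0| <= dl * (1 + Lam lam * V finset.set0).
Proof.
move=> dl0.
have dG j (t : R) : 0 < t -> is_derive t 1 (G j) (mu j * (expR (- lam j * t) - G j t)).
  exact: (is_derive_idle_gt0 lam_gt0 mu_gt0 expX expS indepY).
have Gge1 j (t : R) : 0 <= t -> 1 - lam j * t <= G j t.
  by move=> t0; apply: le_trans (idle_ge_exp j t0); rewrite mulNr expR_ge1Dx.
have Ganti j (t u : R) : 0 <= t -> t <= u -> G j u <= G j t.
  by move=> _; exact: idle_anti.
have rie N := riemann_prod_surv lam_gt0 mu_gt0 dG idle_le1 idle_ge_exp Gge1 Ganti
  VE n_gt0 N dl0.
have [_ [V0 _ _ _]] := tail_primitive lam_gt0 mu_gt0 dG idle_le1 idle_ge_exp Gge1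
  VE n_gt0 finset.set0.
have F1 : F dl < 1 by exact: prod_idle_lt1.
have F01 i : 0 <= F (i.+1%:R * dl) <= F dl ^+ i.+1.
  by rewrite prod_idle_ge0 prod_idle_geometric.
have L0 : 0 <= Lam lam by apply: sumr_ge0 => j _; exact: ltW.
pose u := series (fun i => F (i.+1%:R * dl)).
have uE N : u N = \sum_(i < N) F (i.+1%:R * dl) by rewrite /u /series /= big_mkord.
have u_nd : nondecreasing_seq u.
  by apply/nondecreasing_seqP => N; rewrite !uE big_ord_recr /= lerDl prod_idle_ge0.
have u_cvg : cvgn u.
  apply: nondecreasing_is_cvgn => //.
  exists ((dl + Lam lam * dl * V finset.set0 + V finset.set0 + V finset.set0) / dl).
  move=> _ [N _ <-]; apply: (le_trans (u_nd _ _ (leqnSn N))).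
  rewrite uE ler_pdivlMr // mulrC.
  have /ler_normlP[_] := rie N; rewrite lerBlDr => /le_trans; apply.
  rewrite lerD2r lerD2l ler_piMr //.
  apply: le_trans (prod_idle_geometric _ dl0) _.
  by rewrite exprn_ile1 // ?prod_idle_ge0 // ltW.
exists (limn u); split; first exact: u_cvg.
have lhs : `|dl * u N.+1 - V finset.set0| @[N --> \oo] --> `|dl * limn u - V finset.set0|.
  apply: cvg_norm; apply: cvgB; last exact: cvg_cst.
  by apply: cvgM; [exact: cvg_cst|rewrite (cvg_shiftS u); exact: u_cvg].
have rhs : dl * (1 + Lam lam * V finset.set0) + V finset.set0 * F dl ^+ N @[N --> \oo]
    --> dl * (1 + Lam lam * V finset.set0).
  rewrite -[X in _ --> X]addr0; apply: cvgD; first exact: cvg_cst.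
  rewrite -[X in _ --> X](mulr0 (V finset.set0)); apply: cvgM; first exact: cvg_cst.
  by apply: cvg_expr; rewrite ger0_norm ?prod_idle_ge0.
apply: (ler_cvg_to lhs rhs); apply: nearW => N.
rewrite uE; apply: (le_trans (rie N)).
rewrite mulrDr mulr1 mulrA [Lam lam * dl]mulrC lerD2l ler_wpM2l //.
apply: (le_trans (prod_idle_geometric _ dl0)).
by apply: ler_wiXn2l; rewrite ?prod_idle_ge0 ?(ltW F1) //; lia.
Qed.

Lemma count_old_cvg (dl gamma : R) : 0 < dl ->
  series (fun i => F (i.+1%:R * dl)) @ \oo --> gamma ->
  {ae P, forall w, count_upto (old dl) N.+1 w / N.+1%:R @[N --> \oo] --> gamma}.
Proof.
move=> dl0; have F0 := prod_idle_ge0 dl.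
(* A fourth root of the geometric ratio, to match the exponent [4 * i] of the strong law. *)
pose s := Num.sqrt (Num.sqrt (F dl)).
have s4 : s ^+ 4 = F dl.
  by rewrite (exprM s 2 2) sqr_sqrtr ?sqrtr_ge0 // sqr_sqrtr.
have s01 : 0 <= s < 1.
  by rewrite sqrtr_ge0 /= -(@expr_lt1 _ 4) ?sqrtr_ge0 // s4 prod_idle_lt1.
apply: (strong_law (s := s)) => //.
- by move=> k i; exact: measurable_old.
- by move=> k i ik; exact: probability_old.
- by move=> k l i j; exact: probability_oldI.
- move=> i; apply: (le_trans (prod_idle_geometric _ dl0)).
  rewrite exprM s4; apply: ler_wiXn2l => //; exact/ltW/prod_idle_lt1.
Qed.

End grid_events.

(** * Time integral of a path of slope one with downward jumps *)

Section sawtooth_integral.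
Context {R : realType}.
Local Notation leb := (@lebesgue_measure R).
Variable f : R -> R.
Hypothesis f_nd : {homo f : s t / s <= t}.
Hypothesis f_bound : forall t, 0 <= t -> 0 <= f t <= t.

Let A t := t - f t.
Let J T := Rintegral leb `[0, T] A.

Let A_ge0 t : 0 <= t -> 0 <= A t.
Proof. by move=> t0; rewrite subr_ge0; case/andP: (f_bound t0). Qed.

Let itv_lty (b c : bool) (x y : R) :
  (leb [set` Interval (BSide b x) (BSide c y)] < +oo)%E.
Proof. by rewrite lebesgue_measure_itv /=; case: ifP => _; rewrite ltry. Qed.

Let integrable_A T : leb.-integrable `[0, T] (EFin \o A).
Proof.
apply: measurable_bounded_integrable => //.
- exact: itv_lty.
- apply: measurable_funB => //; exact: nondecreasing_measurable.
- exists T; split; first exact: num_real.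
  move=> M TM t /=; rewrite in_itv /= => /andP[t0 tT].
  rewrite ger0_norm ?A_ge0 // lerBlDr; apply: le_trans tT _.
  by apply: le_trans (ltW TM) _; rewrite lerDl; case/andP: (f_bound t0).
Qed.

(** Such a path grows at most at unit speed, so on a cell it is at most its left value plus the
    length, and at least its right value minus the length. *)
Let J_step x y : 0 <= x -> x <= y ->
  [/\ J x <= J y, J y - J x <= (y - x) * (A x + (y - x)) &
      (y - x) * (A y - (y - x)) <= J y - J x].
Proof.
move=> x0; rewrite le_eqVlt => /orP[/eqP <-|xy].
  by rewrite !subrr !mul0r lexx; split.
have JB : J y - J x = Rintegral leb `]x, y] A.
  by apply: Rintegral_itvB; rewrite ?bnd_simp // ltW.
have iA : leb.-integrable `]x, y] (EFin \o A).
  apply: integrableS (integrable_A y) => //.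
  by apply: subset_itvr; rewrite bnd_simp.
have icst c : leb.-integrable `]x, y] (EFin \o (fun=> c : R)).
  apply: measurable_bounded_integrable => //; first exact: itv_lty.
  by exists `|c|; split=> // M cM t _; exact: ltW.
have Icst c : Rintegral leb `]x, y] (fun=> c) = (y - x) * c.
  transitivity (c * fine (leb `]x, y])); first exact: Rintegral_cst.
  by rewrite lebesgue_measure_itv /= lte_fin xy mulrC.
rewrite -subr_ge0 JB; split.
- apply: Rintegral_ge0 => t /=; rewrite in_itv /= => /andP[xt _].
  by apply: A_ge0; exact: le_trans x0 (ltW xt).
- rewrite -Icst; apply: le_Rintegral => // t /=; rewrite in_itv /= => /andP[xt ty].
  by rewrite /A; have := f_nd (ltW xt); lra.
- rewrite -Icst; apply: le_Rintegral => // t /=; rewrite in_itv /= => /andP[xt ty].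
  by rewrite /A; have := f_nd ty; lra.
Qed.

Variable dl : R.
Hypothesis dl_gt0 : 0 < dl.

Lemma count_multiples k (a : R) : 0 <= a -> a <= k%:R * dl ->
  dl * (\sum_(i < k) (i.+1%:R * dl <= a)%R%:R) <= a <=
  dl * (\sum_(i < k) (i.+1%:R * dl <= a)%R%:R + 1).
Proof.
move=> a0; have sum_all m : m%:R * dl <= a ->
    \sum_(i < m) (i.+1%:R * dl <= a)%R%:R = m%:R :> R.
  move=> ma; rewrite (eq_bigr (fun=> 1)) ?sumr_const ?card_ord // => i _.
  rewrite (le_trans _ ma) // ler_wpM2r ?(ltW dl_gt0) // ler_nat.
  exact: ltn_ord.
elim: k => [|k IH] ak.
  rewrite big_ord0 add0r mulr0 mulr1; move: ak; rewrite mul0r => ak.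
  by rewrite a0 (le_trans ak) // ltW.
have [ka|ak1] := leP (k.+1%:R * dl) a.
  rewrite sum_all // ![dl * _]mulrC ka (le_trans ak) // ler_pM2r //.
  by rewrite lerDl.
have nk : (k.+1%:R * dl <= a) = false by rewrite leNgt ak1.
rewrite big_ord_recr /= nk addr0.
have [/IH //|ka] := leP a (k%:R * dl).
rewrite sum_all; last exact: ltW.
by rewrite ![dl * _]mulrC natr1 !ltW.
Qed.

Let level k : R := \sum_(i < k) (i.+1%:R * dl <= A (k%:R * dl))%R%:R.

Let grid_ge0 k : 0 <= k%:R * dl. Proof. by rewrite mulr_ge0 // ltW. Qed.

Let level_bounds k : dl * level k <= A (k%:R * dl) <= dl * (level k + 1).
Proof.
apply: count_multiples; first exact: A_ge0.
by rewrite /A gerBl; case/andP: (f_bound (grid_ge0 k)).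
Qed.

Let J_grid N :
  dl ^+ 2 * (\sum_(k < N.+1) level k) - N%:R * dl ^+ 2 <= J (N%:R * dl)
    <= dl ^+ 2 * (\sum_(k < N) level k) + 2 * N%:R * dl ^+ 2.
Proof.
have level0 : level 0 = 0 by rewrite /level big_ord0.
elim: N => [|N /andP[IH1 IH2]].
  rewrite big_ord1 big_ord0 level0 !(mulr0, mul0r, subr0, addr0).
  have J0 : J 0 = 0 by rewrite /J set_itv1 Rintegral_set1.
  by rewrite J0 lexx.
have gN : N.+1%:R * dl - N%:R * dl = dl by rewrite -natr1; ring.
have le_grid : N%:R * dl <= N.+1%:R * dl by rewrite ler_pM2r // ler_nat.
have [_] := J_step (grid_ge0 N) le_grid; rewrite gN => H1 H2.
have /andP[a1 a2] := level_bounds N; have /andP[b1 b2] := level_bounds N.+1.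
have H1' := le_trans H1 (ler_wpM2l (ltW dl_gt0) (lerD a2 (lexx dl))).
have H2' := le_trans (ler_wpM2l (ltW dl_gt0) (lerB b1 (lexx dl))) H2.
rewrite big_ord_recr /= in IH1; rewrite !big_ord_recr /=.
set a := J (N%:R * dl) in H1' H2' IH1 IH2 *; set b := J (N.+1%:R * dl) in H1' H2' *.
set u := level N in H1' H2' IH1 IH2 *; set v := level N.+1 in H1' H2' *.
rewrite -[N.+1%:R]natr1 !expr2 in IH1 IH2 *.
move: (\sum_(k < N) level k) (N%:R : R) IH1 IH2 => s m h3 h4.
by apply/andP; split; lra.
Qed.

(* The integral of a sawtooth function over [0, T] through the level counts
   [level k], the number of multiples of [dl] below [A (k * dl)]. *)
Lemma sawtooth_integral_grid N T : N%:R * dl <= T -> T <= N.+1%:R * dl ->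
  dl ^+ 2 * (\sum_(k < N.+1) \sum_(i < k) (i.+1%:R * dl <= A (k%:R * dl))%R%:R) -
    N%:R * dl ^+ 2 <= Rintegral leb `[0, T] A <=
  dl ^+ 2 * (\sum_(k < N.+1) \sum_(i < k) (i.+1%:R * dl <= A (k%:R * dl))%R%:R) +
    2 * N.+1%:R * dl ^+ 2.
Proof.
move=> NT TN; have T0 := le_trans (grid_ge0 N) NT.
have [H1 _ _] := J_step (grid_ge0 N) NT; have [H2 _ _] := J_step T0 TN.
have /andP[lo _] := J_grid N; have /andP[_ hi] := J_grid N.+1.
by rewrite (le_trans lo H1) (le_trans H2 hi).
Qed.

End sawtooth_integral.

(** * Age along one sample path *)

Section pathwise.
Context {d : measure_display} {Omega : measurableType d} {R : realType}.
Variables (n : nat) (X S : 'I_n -> nat -> Omega -> R) (w : Omega).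
Hypothesis times_ge0 : forall j k, 0 <= X j k w /\ 0 <= S j k w.

Let delivered_by t := [set 0] `|` [set g | exists j k, [/\ delivered X S j k w,
  g = arrival X j k w & arrival X j k w + S j k w <= t]].

Let delivered_by_ub t : ubound (delivered_by t) (Num.max 0 t).
Proof.
move=> _ [->|[j [k [_ -> le_t]]]]; first by rewrite le_max lexx.
rewrite le_max; apply/orP; right; apply: le_trans le_t.
by rewrite lerDl; exact: (times_ge0 j k).2.
Qed.

Let delivered_by_has_ub t : has_ubound (delivered_by t).
Proof. by exists (Num.max 0 t); exact: delivered_by_ub. Qed.

(** [tau] must be nonnegative because 0 belongs to the set whose supremum is taken. Boundedness of
    that set comes from deliveries never preceding generation. *)
Lemma freshest_le_stale (t tau : R) : 0 <= tau ->
  (freshest X S w t <= tau) <-> forall j, stale X S j t tau w.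
Proof.
move=> tau0; split=> [le_tau j m dm le_t|st].
  apply: le_trans le_tau; apply: ub_le_sup; first exact: delivered_by_has_ub.
  by right; exists j, m.
apply: ge_sup; first by exists 0; left.
by move=> _ [->//|[j [k [dk -> le_t]]]]; exact: st.
Qed.

Lemma freshest_homo : {homo freshest X S w : s t / s <= t}.
Proof.
move=> s t st; apply: ge_sup; first by exists 0; left.
move=> g gs; apply: ub_le_sup; first exact: delivered_by_has_ub.
case: gs => [->|[j [k [dk -> le_s]]]]; first by left.
by right; exists j, k; split=> //; exact: le_trans le_s st.
Qed.

Lemma freshest_bounds (t : R) : 0 <= t -> 0 <= freshest X S w t <= t.
Proof.
move=> t0; apply/andP; split.
  by apply: ub_le_sup; [exact: delivered_by_has_ub|left].
apply: ge_sup; first by exists 0; left.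
by move=> g /delivered_by_ub; rewrite max_r.
Qed.

Lemma count_uptoE (dl : R) N : 0 < dl ->
  \sum_(k < N) \sum_(i < k) (i.+1%:R * dl <= age X S w (k%:R * dl))%R%:R =
  count_upto (old X S dl) N w :> R.
Proof.
move=> dl0; apply: eq_bigr => k _; apply: eq_bigr => i _.
rewrite indicE.
suff -> : (i.+1%:R * dl <= age X S w (k%:R * dl)) = (w \in old X S dl k i) by [].
have -> : (i.+1%:R * dl <= age X S w (k%:R * dl)) =
    (freshest X S w (k%:R * dl) <= (k - i.+1)%N%:R * dl).
  by rewrite natrB ?ltn_ord // mulrBl /age lerBrDr lerBrDl.
have tau0 : 0 <= (k - i.+1)%N%:R * dl by rewrite mulr_ge0 // ltW.
apply/idP/idP; first by move=> /(freshest_le_stale _ tau0) st; apply/mem_set.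
by move=> /set_mem st; apply/(freshest_le_stale _ tau0).
Qed.

(** Of the 4, one unit is the deviation of the count and at most two come from the integral. The
    last absorbs the ratio of T to the grid, once N dominates gamma. *)
Lemma avg_age_dist (dl gamma T : R) N : 0 < dl -> `|gamma| + 4 <= N%:R ->
  N%:R * dl <= T -> T <= N.+1%:R * dl ->
  `|count_upto (old X S dl) N.+1 w / N.+1%:R - gamma| <= 1 ->
  `|avg_age_upto X S w T - dl * gamma| <= 4 * dl.
Proof.
move=> dl0 gN NT TN; set c := count_upto _ _ _ / _ => cg.
have N0 : 0 < N%:R :> R.
  by apply: lt_le_trans gN; rewrite ltr_wpDl.
have T0 : 0 < T by apply: lt_le_trans NT; rewrite mulr_gt0.
have := sawtooth_integral_grid freshest_homo freshest_bounds dl0 NT TN.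
rewrite count_uptoE // (_ : count_upto _ _ _ = N.+1%:R * c); last first.
  by rewrite /c mulrC divfK // pnatr_eq0.
have -> : avg_age_upto X S w T =
    T^-1 * Rintegral lebesgue_measure `[0, T] (fun t => t - freshest X S w t) by [].
set I := Rintegral _ _ _.
clearbody I c; move: cg; rewrite ler_norml => /andP[c1 c2].
move: gN TN; have /andP[g1 g2] : - `|gamma| <= gamma <= `|gamma|.
  by rewrite -ler_norml.
move: `|gamma| (normr_ge0 gamma) g1 g2 => ag ag0 g1 g2.
rewrite -[N.+1%:R]natr1; move: (N%:R : R) N0 NT => m m0 mT gm Tm /andP[lo hi].
have dl2 : 0 < dl ^+ 2 by rewrite exprn_gt0.
rewrite ler_distl -[T^-1 * I]mulrC ler_pdivlMr // ler_pdivrMr //.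
apply/andP; split.
  (* The sign of the factor of T decides which end of the cell bounds the product. *)
  apply: le_trans lo; have [g3|g3] := leP 4 gamma.
    apply: (@le_trans _ _ ((dl * gamma - 4 * dl) * ((m + 1) * dl))).
      by apply: ler_wpM2l => //; nra.
    have -> : (dl * gamma - 4 * dl) * ((m + 1) * dl) = dl ^+ 2 * ((gamma - 4) * (m + 1)) by ring.
    rewrite [m * _]mulrC -mulrBr ler_pM2l //; nra.
  apply: (@le_trans _ _ ((dl * gamma - 4 * dl) * (m * dl))).
    by apply: ler_wnM2l => //; nra.
  have -> : (dl * gamma - 4 * dl) * (m * dl) = dl ^+ 2 * ((gamma - 4) * m) by ring.
  rewrite [m * _]mulrC -mulrBr ler_pM2l //; nra.
apply: le_trans hi _; have [g3|g3] := leP 0 (gamma + 4).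
  apply: (@le_trans _ _ ((dl * gamma + 4 * dl) * (m * dl))); last first.
    by apply: ler_wpM2l => //; nra.
  have -> : (dl * gamma + 4 * dl) * (m * dl) = dl ^+ 2 * ((gamma + 4) * m) by ring.
  rewrite [X in _ + X]mulrC -mulrDr ler_pM2l //; nra.
apply: (@le_trans _ _ ((dl * gamma + 4 * dl) * ((m + 1) * dl))); last first.
  by apply: ler_wnM2l => //; nra.
have -> : (dl * gamma + 4 * dl) * ((m + 1) * dl) = dl ^+ 2 * ((gamma + 4) * (m + 1)) by ring.
rewrite [X in _ + X]mulrC -mulrDr ler_pM2l //; nra.
Qed.

End pathwise.

Theorem theorem4 (R : realType) (d : measure_display) (Omega : measurableType d)
    (P : probability Omega R) (n : nat) (hn : (0 < n)%N)
    (lam mu : 'I_n -> R) (X S : 'I_n -> nat -> Omega -> R) :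
  (forall j, 0 < lam j) -> (forall j, 0 < mu j) ->
  (forall j k, exp_distributed P (lam j) (X j k)) ->
  (forall j k, exp_distributed P (mu j) (S j k)) ->
  mutually_independent P (all_times X S) ->
  [/\ exists v, age_system hn lam mu v,
      forall v w, age_system hn lam mu v -> age_system hn lam mu w -> v = w
    & forall v, age_system hn lam mu v ->
        (forall q j, 0 <= v q j) /\
        {ae P, forall om, avg_age_upto X S om T @[T --> +oo] -->
                            \sum_(q : 'S_n) v q None}].
Proof.
move=> lam_gt0 mu_gt0 expX expS indep; split.
- have [v vE] := balance_surj hn lam_gt0 mu_gt0 (fun q _ => piq lam q).
  by exists v; apply/age_systemE.
- move=> v w /age_systemE vE /age_systemE wE.
  by apply: (balance_inj lam_gt0 mu_gt0) => q x; rewrite vE wE.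
move=> v /age_systemE vE; split.
  by apply: (balance_ge0 lam_gt0 mu_gt0) => q x; rewrite vE; exact: piq_ge0.
have VE (A : {set 'I_n}) : (\sum_(j in A) lam j + \sum_(j in ~: A) mu j) * aggregate v A =
    1 + \sum_(j in ~: A) mu j * aggregate v (j |: A).
  rewrite (aggregateE hn lam mu v A); congr (_ + _); rewrite -(sum_piq lam_gt0).
  by apply: eq_bigr => q _; rewrite vE.
have -> : \sum_(q : 'S_n) v q None = aggregate v finset.set0.
  by apply: eq_bigr => q _; rewrite freshest_in0.
(* Countably many meshes, so that one null set serves them all. *)
pose dl (p : nat) : R := p.+1%:R^-1.
have dl0 p : 0 < dl p by rewrite invr_gt0 ltr0n.
have H p := mean_old_cvg hn lam_gt0 mu_gt0 expX expS indep VE (dl0 p).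
have /choice[gamma gammaE] := H.
have Hcount : {ae P, forall om, forall p,
    count_upto (old X S (dl p)) N.+1 om / N.+1%:R @[N --> \oo] --> gamma p}.
  apply: ae_foralln => p; have [gp _] := gammaE p.
  exact: (count_old_cvg hn lam_gt0 mu_gt0 expX expS indep (dl0 p) gp).
move: Hcount (times_ge0_ae expX expS); apply: filterS2 => om Hcount om0.
set V := aggregate v finset.set0 in gammaE *; set K := 1 + Lam lam * V in gammaE.
apply/cvgrPdist_le => e e0.
(* The summand with [K] is the distance of [dl * gamma] to the limit from [mean_old_cvg]; 4 is the
   pathwise error of [avg_age_dist]. *)
have [p pe] : exists p, dl p * (`|K| + 4) <= e.
  exists (Num.truncn ((`|K| + 4) / e)); rewrite mulrC ler_pdivrMr ?ltr0n //.
  by rewrite mulrC -ler_pdivrMr // ltW // truncnS_gt.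
have [_ gV] := gammaE p.
have [N0 _ HN] : \forall N \near \oo,
    `|count_upto (old X S (dl p)) N.+1 om / N.+1%:R - gamma p| <= 1 /\
    `|gamma p| + 4 <= N%:R.
  near=> N; split; near: N; last exact: nbhs_infty_ger.
  have /cvgrPdist_le /(_ 1 ltr01) := Hcount p.
  by apply: filterS => N; rewrite distrC.
move: (nbhs_pinfty_ge (num_real (0 : R)))
  (nbhs_pinfty_ge (num_real (N0%:R * dl p))).
apply: filterS2 => T T_ge0 T_large.
have T0 : 0 <= T / dl p by rewrite divr_ge0 // ltW.
have /andP[NT TN] := truncn_itv T0; set N := Num.truncn _ in NT TN.
have NT' : N%:R * dl p <= T by rewrite -ler_pdivlMr.
have TN' : T <= N.+1%:R * dl p by rewrite -ler_pdivrMr // ltW.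
have NN0 : (N0 <= N)%N.
  by rewrite -ltnS -(ltr_nat R) (le_lt_trans _ TN) // ler_pdivlMr.
have [cg gN] := HN N NN0.
have avg := avg_age_dist om0 (dl0 p) gN NT' TN' cg.
apply: le_trans pe; rewrite distrC.
apply: (le_trans (ler_distD (dl p * gamma p) _ _)).
rewrite mulrDr addrC; apply: lerD; last by rewrite [_ * 4]mulrC.
by apply: (le_trans gV); rewrite ler_pM2l // ler_norm.
Unshelve. all: by end_near. Qed.
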